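(* For $0<\varepsilon<\frac12$ let $\Gamma=\Gamma_\varepsilon$ be the metric tree with vertices $v_0, v_l, v_r, w_u, w_d, v_{u_1}, v_{u_2}, v_{d_1}, v_{d_2}$ and the following eight edges: two edges of length $1$, joining $v_0$ to $v_l$ and $v_0$ to $v_r$; and six edges of length $\frac12-\varepsilon$, joining $v_0$ to $w_u$, $v_0$ to $w_d$, $w_u$ to $v_{u_1}$, $w_u$ to $v_{u_2}$, $w_d$ to $v_{d_1}$, and $w_d$ to $v_{d_2}$. Let $\mathcal{P}^2\subset\Gamma$ be the path joining $v_l$ and $v_r$, and let $\mathcal{S}^2\subset\Gamma$ be the subgraph formed by the six edges of length $\frac12-\varepsilon$. Then $\operatorname{diam}(\Gamma)=2$ and the diameter is realised only by the path joining $v_l$ and $v_r$. Moreover, for all sufficiently small $\varepsilon>0$, the eigenvalue $\mu_2(\Gamma)$ of the standard Laplacian $-\Delta_\Gamma$ is simple, and its (unique up to scalar multiples, real-valued) eigenfunction $f$ vanishes identically on $\mathcal{P}^2$, is supported on $\mathcal{S}^2$, and, after possibly replacing $f$ by $-f$, attains its global maximum over $\Gamma$ at the vertices $v_{u_1}, v_{u_2}$ and its global minimum over $\Gamma$ at the vertices $v_{d_1}, v_{d_2}$. In particular, the global maxima and minima of an eigenfunction corresponding to $\mu_2$ of a metric tree need not be located at points realising the diameter of the tree.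
   Context: A finite, compact metric graph $\Gamma$ consists of a finite vertex set $V$ and a finite edge set $E$, where each edge $e \in E$ is identified with a compact interval $[0,\ell_e]$ of finite length $\ell_e>0$ whose endpoints are identified with vertices; $\Gamma$ is regarded as a compact metric space with the shortest-path distance $\operatorname{dist}$, and $\operatorname{diam}(\Gamma)=\max_{x,y\in\Gamma}\operatorname{dist}(x,y)$. It is a tree if it is connected and contains no cycles. The standard (or Kirchhoff) Laplacian $-\Delta_\Gamma$ is the self-adjoint operator in $L^2(\Gamma) = \bigoplus_{e\in E} L^2(0,\ell_e)$ acting as $f \mapsto -f''$ on each edge, with domain consisting of all $f$ whose restriction to each edge $e$ lies in the Sobolev space $H^2(0,\ell_e)$ and which satisfy the standard (continuity-Kirchhoff) conditions at each vertex $v$: $f$ is continuous at $v$, and the sum over all edge ends at $v$ of the derivatives of $f$ at $v$, taken in the direction pointing into $v$, is zero (at a vertex of degree one this is the Neumann condition). Its spectrum is discrete, and its eigenvalues, counted with multiplicity, are $0=\mu_1(\Gamma)\le \mu_2(\Gamma)\le\ldots$. If $\Gamma$ is connected then $\mu_2(\Gamma)>0$, so $\mu_2(\Gamma)$ is the first positive eigenvalue. *)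

(* Defs.v *)
(* Developed in MathComp / MathComp-Analysis, over an arbitrary realType R. *)
From HB Require Import structures.
From mathcomp Require Import all_boot all_order all_algebra.
From mathcomp Require Import all_classical all_reals all_analysis.

Set Implicit Arguments.
Unset Strict Implicit.
Unset Printing Implicit Defensive.

Import Order.TTheory GRing.Theory Num.Theory.
Import numFieldNormedType.Exports.

Local Open Scope classical_set_scope.
Local Open Scope ring_scope.

(* Loops and multiple edges are allowed.  The edge e is a copy of [0, len e],
   with 0 glued to src e and len e glued to tgt e; this orientation is only a
   choice of coordinate.  Every vertex is the end of some edge: an isolated
   vertex would be invisible to L^2. *)
Record metricGraph (R : realType) := MetricGraph {
  vertex : finType;
  edge : finType;
  len : edge -> R;
  len_gt0 : forall e, 0 < len e;
  src : edge -> vertex;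
  tgt : edge -> vertex;
  vertex_incident : forall v, exists e, (src e == v) || (tgt e == v)
}.

(* The points of the glued space, one representative per class: a vertex, or
   an edge with a coordinate strictly between its two ends. *)
Definition mg_point (R : realType) (G : metricGraph R) : Type :=
  (vertex G + {e : edge G & {x : R | 0 < x < len e}})%type.

Definition vpt (R : realType) (G : metricGraph R) (v : vertex G) :
    mg_point G :=
  inl v.

(* The quotient map: the point with coordinate x on the edge e.  It is only
   meaningful for 0 <= x <= len e; other x are sent to the nearest end. *)
Definition pt (R : realType) (G : metricGraph R) (e : edge G) (x : R) :
    mg_point G :=
  if x <= 0 then inl (src e) else
  if (insub x : option {x : R | 0 < x < len e}) is Some y
  then inr (Tagged (fun e => {x : R | 0 < x < len e}) y)
  else inl (tgt e).

Definition edge_set (R : realType) (G : metricGraph R) (e : edge G) :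
    set (mg_point G) := pt e @` `[0, len e].

(* walk p q L: one can go from p to q by finitely many moves, each inside a
   single closed edge, of total length L. *)
Inductive walk (R : realType) (G : metricGraph R) :
    mg_point G -> mg_point G -> R -> Prop :=
| walk_nil p : walk p p 0
| walk_cons e x y q L :
    0 <= x <= len e -> 0 <= y <= len e ->
    walk (pt e y) q L -> walk (pt e x) q (`|x - y| + L).

(* Extended-valued, so that points in different components are at distance
   +oo. *)
Definition mg_dist (R : realType) (G : metricGraph R) (p q : mg_point G) :
    \bar R :=
  ereal_inf [set L%:E | L in [set L : R | walk p q L]].

Definition mg_diam (R : realType) (G : metricGraph R) : \bar R :=
  ereal_sup [set d | exists p q : mg_point G, d = mg_dist p q].

(* P is the trace of a shortest path from p to q, parametrised by arc
   length. *)
Definition shortest_path (R : realType) (G : metricGraph R) (p q : mg_point G)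
    (P : set (mg_point G)) : Prop :=
  exists (L : R) (gamma : R -> mg_point G),
    [/\ 0 <= L, gamma 0 = p, gamma L = q,
        (forall s t, 0 <= s <= L -> 0 <= t <= L ->
           mg_dist (gamma s) (gamma t) = `|s - t|%:E)
      & P = gamma @` `[0, L]].

Definition connected_graph (R : realType) (G : metricGraph R) : Prop :=
  forall u v : vertex G,
    connect (fun a b => [exists e : edge G,
      ((src e == a) && (tgt e == b)) || ((src e == b) && (tgt e == a))]) u v.

(* An edge with a direction of travel, true being from src to tgt. *)
Definition arc_from (R : realType) (G : metricGraph R) (a : edge G * bool) :
    vertex G := if a.2 then src a.1 else tgt a.1.

Definition arc_to (R : realType) (G : metricGraph R) (a : edge G * bool) :
    vertex G := if a.2 then tgt a.1 else src a.1.

Definition graph_cycle (R : realType) (G : metricGraph R)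
    (c : seq (edge G * bool)) : bool :=
  [&& c != [::], cycle (fun a b => arc_to a == arc_from b) c,
      uniq (map fst c) & uniq (map (@arc_from R G) c)].

Definition is_tree (R : realType) (G : metricGraph R) : Prop :=
  connected_graph G /\ forall c : seq (edge G * bool), ~~ graph_cycle c.

Definition square_integrable (R : realType) (l : R) (g : R -> R) : Prop :=
  measurable_fun (`[0, l] : set R) g /\
  (@lebesgue_measure R).-integrable `[0, l] (fun x => (g x ^+ 2)%:E).

(* u is in H^2(0, l), with derivatives u' = u1 and u'' = u2: both u and u1 are
   absolutely continuous on [0, l], being the primitives of u1 and u2, and u2
   is in L^2(0, l).  Here u and u1 are the representatives that are continuous
   up to the ends, so that u 0, u l, u1 0 and u1 l are the boundary values;
   u2 is determined only almost everywhere. *)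
Definition H2_derivatives (R : realType) (l : R) (u u1 u2 : R -> R) : Prop :=
  square_integrable l u2 /\
  forall x, 0 <= x <= l ->
    u x = u 0 + \int[@lebesgue_measure R]_(t in `[0, x]) u1 t /\
    u1 x = u1 0 + \int[@lebesgue_measure R]_(t in `[0, x]) u2 t.

(* Derivatives are taken into the vertex, whence +f' at the tgt end and -f' at
   the src end; a loop contributes both. *)
Definition kirchhoff (R : realType) (G : metricGraph R)
    (f1 : edge G -> R -> R) : Prop :=
  forall v : vertex G,
    \sum_(e | tgt e == v) f1 e (len e) - \sum_(e | src e == v) f1 e 0 = 0.

(* The graph of the operator: f is in the domain of the standard Laplacian and
   g is a representative of -f'' in L^2.  Continuity of f at the vertices is
   built in: f is a function on the glued space, and H2_derivatives makes it
   continuous along every closed edge, ends included. *)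
Definition std_laplacian (R : realType) (G : metricGraph R)
    (f g : mg_point G -> R) : Prop :=
  exists f1 f2 : edge G -> R -> R,
    [/\ forall e, H2_derivatives (len e) (fun x => f (pt e x)) (f1 e) (f2 e),
        kirchhoff f1
      & forall e, {ae @lebesgue_measure R, forall x,
          0 <= x <= len e -> g (pt e x) = - f2 e x}].

Definition mg_eigenspace (R : realType) (G : metricGraph R) (lam : R) :
    set (mg_point G -> R) :=
  [set f | std_laplacian f (fun p => lam * f p)].

Definition eigenfunction (R : realType) (G : metricGraph R) (lam : R)
    (f : mg_point G -> R) : Prop :=
  mg_eigenspace lam f /\ exists p, f p != 0.

(* The eigenspace of lam has a basis of n elements; n = 0 means that lam is
   not an eigenvalue. *)
Definition multiplicity (R : realType) (G : metricGraph R) (lam : R)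
    (n : nat) : Prop :=
  exists F : 'I_n -> mg_point G -> R,
    [/\ forall i, mg_eigenspace lam (F i),
        forall c : 'I_n -> R,
          (forall p, \sum_(i < n) c i * F i p = 0) -> forall i, c i = 0
      & forall f, mg_eigenspace lam f ->
          exists c : 'I_n -> R, forall p, f p = \sum_(i < n) c i * F i p].

(* lam = mu_k(G), with k counted from 1: s followed by lam is the list of the
   k first eigenvalues in nondecreasing order, each repeated according to its
   multiplicity (for lam itself, at most its multiplicity, as the list may stop
   before all its repetitions). *)
Definition is_mu (R : realType) (G : metricGraph R) (k : nat) (lam : R) :
    Prop :=
  exists s : seq R,
    [/\ size (rcons s lam) = k,
        sorted <=%R (rcons s lam),
        forall x, x < lam -> multiplicity G x (count_mem x (rcons s lam))
      & exists2 m, multiplicity G lam m & (count_mem lam (rcons s lam) <= m)%N].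

Definition is_global_max (R : realType) (G : metricGraph R)
    (f : mg_point G -> R) (p : mg_point G) : Prop := forall q, f q <= f p.

Definition is_global_min (R : realType) (G : metricGraph R)
    (f : mg_point G -> R) (p : mg_point G) : Prop := forall q, f p <= f q.

Inductive gvertex := v_0 | v_l | v_r | w_u | w_d | v_u1 | v_u2 | v_d1 | v_d2.

Definition gvertex_enum :=
  [:: v_0; v_l; v_r; w_u; w_d; v_u1; v_u2; v_d1; v_d2].

Definition gvertex_code (v : gvertex) : nat :=
  match v with
  | v_0 => 0 | v_l => 1 | v_r => 2 | w_u => 3 | w_d => 4
  | v_u1 => 5 | v_u2 => 6 | v_d1 => 7 | v_d2 => 8
  end.

Lemma gvertex_codeK : cancel gvertex_code (nth v_0 gvertex_enum).
Proof. by case. Qed.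

HB.instance Definition _ := Countable.copy gvertex (can_type gvertex_codeK).

Lemma gvertex_enumP : Finite.axiom gvertex_enum.
Proof. by case. Qed.

HB.instance Definition _ := fintype.isFinite.Build gvertex gvertex_enumP.

Inductive gedge := e_l | e_r | e_u | e_d | e_u1 | e_u2 | e_d1 | e_d2.

Definition gedge_enum := [:: e_l; e_r; e_u; e_d; e_u1; e_u2; e_d1; e_d2].

Definition gedge_code (e : gedge) : nat :=
  match e with
  | e_l => 0 | e_r => 1 | e_u => 2 | e_d => 3
  | e_u1 => 4 | e_u2 => 5 | e_d1 => 6 | e_d2 => 7
  end.

Lemma gedge_codeK : cancel gedge_code (nth e_l gedge_enum).
Proof. by case. Qed.

HB.instance Definition _ := Countable.copy gedge (can_type gedge_codeK).

Lemma gedge_enumP : Finite.axiom gedge_enum.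
Proof. by case. Qed.

HB.instance Definition _ := fintype.isFinite.Build gedge gedge_enumP.

Definition gsrc (e : gedge) : gvertex :=
  match e with
  | e_l | e_r | e_u | e_d => v_0
  | e_u1 | e_u2 => w_u
  | e_d1 | e_d2 => w_d
  end.

Definition gtgt (e : gedge) : gvertex :=
  match e with
  | e_l => v_l | e_r => v_r | e_u => w_u | e_d => w_d
  | e_u1 => v_u1 | e_u2 => v_u2 | e_d1 => v_d1 | e_d2 => v_d2
  end.

Definition glen (R : realType) (eps : R) (e : gedge) : R :=
  match e with
  | e_l | e_r => 1
  | _ => 2^-1 - eps
  end.

Lemma glen_gt0 (R : realType) (eps : R) :
  0 < eps < 2^-1 -> forall e, 0 < glen eps e.
Proof. by move=> /andP[_ h] []; rewrite /= ?ltr01 ?subr_gt0. Qed.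

Lemma gvertex_incident (v : gvertex) :
  exists e, (gsrc e == v) || (gtgt e == v).
Proof.
by case: v; [exists e_l|exists e_l|exists e_r|exists e_u|exists e_d|exists e_u1
            |exists e_u2|exists e_d1|exists e_d2].
Qed.

Definition Gamma (R : realType) (eps : R) (heps : 0 < eps < 2^-1) :
    metricGraph R :=
  MetricGraph (glen_gt0 heps) gvertex_incident.

Definition gpt (R : realType) (eps : R) (heps : 0 < eps < 2^-1)
    (v : gvertex) : mg_point (Gamma heps) := @vpt R (Gamma heps) v.

Definition P2 (R : realType) (eps : R) (heps : 0 < eps < 2^-1) :
    set (mg_point (Gamma heps)) :=
  \bigcup_(e in [set e_l; e_r]) @edge_set R (Gamma heps) e.

Definition S2 (R : realType) (eps : R) (heps : 0 < eps < 2^-1) :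
    set (mg_point (Gamma heps)) :=
  \bigcup_(e in [set e_u; e_d; e_u1; e_u2; e_d1; e_d2])
    @edge_set R (Gamma heps) e.

Arguments P2 {R eps} heps _.
Arguments S2 {R eps} heps _.

(* Main.v *)
Require Import Defs.
From mathcomp Require Import all_boot all_order all_algebra.
From mathcomp Require Import all_classical all_reals all_analysis.
From mathcomp Require Import measurable_realfun zify ring lra.

Set Implicit Arguments.
Unset Strict Implicit.
Unset Printing Implicit Defensive.

Import Order.TTheory GRing.Theory Num.Theory.
Import numFieldNormedType.Exports.

Local Open Scope classical_set_scope.
Local Open Scope ring_scope.

(* Distances are bounded below by functions of slope +-1 along the edges (the
   distances to v_l and to v_r) and above by walks through v_0; the six short
   edges stay at height < 1 above v_0, so only v_l and v_r are 2 apart.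

   On an edge an eigenfunction is a classical solution of -u'' = lam u.  For
   lam <= 0 the flux u u' is nondecreasing along each edge, while its total
   increment over the graph is 0 by Kirchhoff; so lam < 0 is impossible and
   lam = 0 gives the constants.  For lam = k^2 > 0, with l = 1/2 - eps,
   C = cos (k l) and S = sin (k l), solving inward from the Neumann leaves gives
     f v_0 = a D = b D = p cos k = q cos k,  D = C^2 - 2 S^2,
     3 C S (a + b) + (p + q) sin k = 0
   for the leaf values a (up), b (down), p, q (ends of the diameter).  While
   D > 0 and k < pi/2 all terms have the same sign and f = 0.  The first
   nonzero solution occurs at D = 0, i.e. k l = acos (sqrt (2/3)) < pi/4, where
   p = q = 0 and b = - a; this k is < pi/2 once eps is small. *)

(** * Solutions on one edge *)

(** On a bounded interval [1 + g ^+ 2] is integrable and dominates [|g|]. *)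
Lemma square_integrable_integrable (R : realType) (L : R) (g : R -> R) :
  square_integrable L g -> (@lebesgue_measure R).-integrable `[0, L] (EFin \o g).
Proof.
move=> [mg ig].
have i1 : (@lebesgue_measure R).-integrable `[0, L] (EFin \o (fun _ : R => 1 : R)).
  apply: continuous_compact_integrable; first exact: segment_compact.
  by apply: continuous_subspaceT => x; exact: cvg_cst.
apply: (le_integrable _ _ _ (integrableD _ i1 ig)) => //=.
- exact/measurable_EFinP.
- move=> x _ /=; rewrite lee_fin.
  rewrite [leRHS]ger0_norm ?addr_ge0 ?sqr_ge0//.
  by rewrite ler_norml; apply/andP; split; nra.
Qed.

Lemma primitive_continuous (R : realType) (L : R) (F f : R -> R) : 0 <= L ->
  (@lebesgue_measure R).-integrable `[0, L] (EFin \o f) ->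
  (forall x, 0 <= x <= L ->
    F x = F 0 + \int[@lebesgue_measure R]_(t in `[0, x]) f t) ->
  {within `[0, L], continuous F}.
Proof.
move=> L0 intf FE.
apply: (@subspace_eq_continuous _ _ _
  (fun x => F 0 + parameterized_integral (@lebesgue_measure R) 0 x f)).
  by move=> x; rewrite inE/= in_itv/= => xin; exact/esym/FE.
move=> x; apply: cvgD; first exact: cvg_cst.
exact: parameterized_integral_continuous.
Qed.

(** The integral formula for [F] holds only on the edge, so the fundamental theorem of calculus is
    applied at an interior point, where both sides agree on a neighbourhood. *)
Lemma primitive_is_derive (R : realType) (L x : R) (F f : R -> R) :
  (@lebesgue_measure R).-integrable `[0, L] (EFin \o f) ->
  (forall x, 0 <= x <= L ->
    F x = F 0 + \int[@lebesgue_measure R]_(t in `[0, x]) f t) ->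
  {within `[0, L], continuous f} ->
  x \in `]0, L[ -> is_derive x 1 F (f x).
Proof.
move=> intf FE cf /[dup] xin; rewrite in_itv/= => /andP[x0 xL].
have cfx : {for x, continuous f}.
  exact: (within_continuous_continuous (lt_trans x0 xL) cf).
have [d1 d2] := @continuous_FTC1_closed _ f 0 x L xL intf x0 cfx.
apply: (@near_eq_is_derive _ _ _
  (cst (F 0) + (fun x => \int[@lebesgue_measure R]_(t in `[0, x]) f t))).
  near=> y; rewrite /= (FE y)//.
  near: y; apply: filterS (near_in_itvoo xin) => y.
  by rewrite in_itv/= => /andP[/ltW -> /ltW ->].
rewrite -[f x]add0r; apply: is_deriveD.
by rewrite derive1E in d2; exact: DeriveDef d1 d2.
Unshelve. all: by end_near. Qed.

(** The classical form of the equation: derivatives only inside the edge, continuity up to the ends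
    so that boundary values and the mean value theorem are available. *)
Definition edge_solution (R : realType) (lam L : R) (u u1 : R -> R) : Prop :=
  [/\ {within `[0, L], continuous u}, {within `[0, L], continuous u1},
      forall x, x \in `]0, L[ -> is_derive x 1 u (u1 x)
    & forall x, x \in `]0, L[ -> is_derive x 1 u1 (- lam * u x)].

(** Regularity bootstrap: [u] and [u1] are continuous as primitives, and since [u2] is [- lam * u]
    almost everywhere, [u1] is also a primitive of a continuous function. *)
Lemma H2_edge_solution (R : realType) (lam L : R) (u u1 u2 : R -> R) :
  0 <= L -> H2_derivatives L u u1 u2 ->
  {ae @lebesgue_measure R, forall x, 0 <= x <= L -> lam * u x = - u2 x} ->
  edge_solution lam L u u1.
Proof.
move=> L0 [sq2 uE] aeE.
have i2 := square_integrable_integrable sq2.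
have cu1 : {within `[0, L], continuous u1}.
  by apply: (primitive_continuous L0 i2) => x /uE[].
have i1 : (@lebesgue_measure R).-integrable `[0, L] (EFin \o u1).
  by apply: continuous_compact_integrable => //; exact: segment_compact.
have cu : {within `[0, L], continuous u}.
  by apply: (primitive_continuous L0 i1) => x /uE[].
have cu2 : {within `[0, L], continuous (fun x => - lam * u x)}.
  by move=> x; apply: cvgM; [exact: cvg_cst|exact: cu].
have iu : (@lebesgue_measure R).-integrable `[0, L]
    (EFin \o (fun x => - lam * u x)).
  by apply: continuous_compact_integrable => //; exact: segment_compact.
split=> // x xin.
  by apply: (primitive_is_derive i1 _ cu1 xin) => y /uE[].
apply: (primitive_is_derive iu _ cu2 xin) => y /[dup] /andP[y0 yL] /uE[_ ->].
congr (_ + fine _).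
have sub : `[0, y] `<=` `[0, L] by apply: subset_itvl; rewrite bnd_simp.
apply: ae_eq_integral => //.
- have : (@lebesgue_measure R).-integrable `[0, y] (EFin \o u2).
    exact: integrableS i2.
  by case/integrableP.
- have : (@lebesgue_measure R).-integrable `[0, y] (EFin \o (fun x => - lam * u x)).
    exact: integrableS iu.
  by case/integrableP.
- case: aeE => N [mN N0 sN]; exists N; split=> //; apply: subset_trans sN.
  apply: subsetC => z zE; rewrite /= in_itv/= => /andP[z0 zy].
  by rewrite mulNr zE ?opprK// z0 (le_trans zy).
Qed.

Lemma primitiveP (R : realType) (u u1 : R -> R) (x : R) :
  (forall t : R, is_derive t 1 u (u1 t)) -> continuous u1 -> 0 <= x ->
  u x = u 0 + \int[@lebesgue_measure R]_(t in `[0, x]) u1 t.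
Proof.
move=> du cu1; rewrite le_eqVlt => /predU1P[<-|x0].
  by rewrite set_itv1 Rintegral_set1 addr0.
have cu : continuous u.
  by move=> t; apply/differentiable_continuous/derivable1_diffP; case: (du t).
rewrite /Rintegral (@continuous_FTC2 _ u1 u 0 x x0).
- by rewrite -EFinB/= addrC subrK.
- exact: continuous_subspaceT.
- split=> [t _||]; first by case: (du t).
    exact/cvg_at_right_filter/cu.
  exact/cvg_at_left_filter/cu.
- by move=> t _; rewrite derive1E derive_val.
Qed.

(** Here [u] stands for [fun x => f (pt e x)], which is constant beyond the ends of the edge and
    need not be smooth there; [v] is a smooth extension of its restriction to the edge. *)
Lemma edge_solution_H2 (R : realType) (lam L : R) (u v v1 : R -> R) :
  (forall x, 0 <= x <= L -> u x = v x) -> 0 <= L ->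
  (forall t : R, is_derive t 1 v (v1 t)) ->
  (forall t : R, is_derive t 1 v1 (- lam * v t)) ->
  H2_derivatives L u v1 (fun x => - lam * v x).
Proof.
move=> uv L0 dv dv1.
have cv : continuous v.
  by move=> t; apply/differentiable_continuous/derivable1_diffP; case: (dv t).
have cv1 : continuous v1.
  by move=> t; apply/differentiable_continuous/derivable1_diffP; case: (dv1 t).
have cv2 : continuous (fun t => - lam * v t).
  by move=> t; apply: cvgM; [exact: cvg_cst|exact: cv].
split.
  split; first by apply: measurable_funTS; exact: continuous_measurable_fun.
  apply: continuous_compact_integrable; first exact: segment_compact.
  apply: continuous_subspaceT => t; rewrite /=.
  by under eq_fun do rewrite expr2; apply: cvgM; exact: cv2.
move=> x /andP[x0 xL]; split.
  by rewrite !uv ?lexx ?x0//; exact: primitiveP.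
exact: (primitiveP dv1 cv2).
Qed.

Lemma is_derive0_cst_cc (R : realType) (L : R) (w dw : R -> R) :
  {within `[0, L], continuous w} ->
  (forall x, x \in `]0, L[ -> is_derive x 1 w (dw x)) ->
  (forall x, x \in `]0, L[ -> dw x = 0) ->
  forall x, 0 <= x <= L -> w x = w 0.
Proof.
move=> cw dwE dw0 x /andP[x0 xL].
have dw' t : t \in `]0, x[ -> is_derive t 1 w (cst 0 t).
  move=> tin; have tin' : t \in `]0, L[.
    by apply: subset_itvl tin; rewrite bnd_simp.
  by have := dwE t tin'; rewrite dw0.
have cw' : {within `[0, x], continuous w}.
  by apply: continuous_subspaceW cw; apply: subset_itvl; rewrite bnd_simp.
have [c _] := MVT_segment x0 dw' cw'.
by rewrite mul0r => /eqP; rewrite subr_eq0 => /eqP.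
Qed.

(** Rotating the vector [(k * u, u1)] back by the angle [k * x] gives two quantities of zero
    derivative, [A] and [B] below; undoing the rotation gives the formulas, with no appeal to a
    uniqueness theorem for differential equations. *)
Lemma edge_solution_trig (R : realType) (k L : R) (u u1 : R -> R) :
  k != 0 -> edge_solution (k ^+ 2) L u u1 -> forall x, 0 <= x <= L ->
  u x = u 0 * cos (k * x) + u1 0 / k * sin (k * x) /\
  u1 x = u1 0 * cos (k * x) - k * u 0 * sin (k * x).
Proof.
move=> k0 [cu cu1 du du1].
have dk (x : R) : is_derive x 1 (fun t => k * t) k.
  by apply: trigger_derive; rewrite /GRing.scale/= mulr1.
have dcos (x : R) : is_derive x 1 (fun t => cos (k * t)) (- sin (k * x) * k).
  exact: (@is_derive1_comp _ cos (fun t => k * t)).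
have dsin (x : R) : is_derive x 1 (fun t => sin (k * t)) (cos (k * x) * k).
  exact: (@is_derive1_comp _ sin (fun t => k * t)).
have ccos : continuous (fun t => cos (k * t)).
  by move=> t; apply/differentiable_continuous/derivable1_diffP; case: (dcos t).
have csin : continuous (fun t => sin (k * t)).
  by move=> t; apply/differentiable_continuous/derivable1_diffP; case: (dsin t).
have A x : 0 <= x <= L ->
    k * (u x * cos (k * x)) - u1 x * sin (k * x) = k * u 0.
  move=> xL.
  rewrite (@is_derive0_cst_cc _ L
    (fun x => k * (u x * cos (k * x)) - u1 x * sin (k * x)) (cst 0) _ _ _ x xL)//=.
  - by rewrite mulr0 sin0 cos0 mulr1 mulr0 subr0.
  - move=> t; apply: cvgB; apply: cvgM; try exact: cu1; try exact: cvg_cst.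
      by apply: cvgM; [exact: cu|exact: (continuous_subspaceT ccos)].
    exact: (continuous_subspaceT csin).
  - move=> t tin; have := du t tin; have := du1 t tin => ? ?.
    by apply: trigger_derive; rewrite /GRing.scale/=; ring.
have B x : 0 <= x <= L ->
    k * (u x * sin (k * x)) + u1 x * cos (k * x) = u1 0.
  move=> xL.
  rewrite (@is_derive0_cst_cc _ L
    (fun x => k * (u x * sin (k * x)) + u1 x * cos (k * x)) (cst 0) _ _ _ x xL)//=.
  - by rewrite mulr0 sin0 cos0 mulr1 !mulr0 add0r.
  - move=> t; apply: cvgD; apply: cvgM; try exact: cu1; try exact: cvg_cst.
      by apply: cvgM; [exact: cu|exact: (continuous_subspaceT csin)].
    exact: (continuous_subspaceT ccos).
  - move=> t tin; have := du t tin; have := du1 t tin => ? ?.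
    by apply: trigger_derive; rewrite /GRing.scale/=; ring.
move=> x xL; have := A x xL; have := B x xL; have := cos2Dsin2 (k * x).
set c := cos _; set s := sin _ => cs eB eA.
split.
  apply: (mulfI k0); transitivity (k * u 0 * c + u1 0 * s); last by field.
  by rewrite -eA -eB -[k * u x]mulr1 -cs; ring.
by rewrite -eB -eA -[LHS]mulr1 -cs; ring.
Qed.

Lemma edge_solution_flux (R : realType) (lam L : R) (u u1 : R -> R) :
  edge_solution lam L u u1 ->
  {within `[0, L], continuous (fun x => u x * u1 x)} /\
  forall x, x \in `]0, L[ ->
    is_derive x 1 (fun x => u x * u1 x) (u1 x ^+ 2 - lam * u x ^+ 2).
Proof.
move=> [cu cu1 du du1]; split; first by move=> t; apply: cvgM; [exact: cu|exact: cu1].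
move=> t tin; have := du t tin; have := du1 t tin => ? ?.
by apply: trigger_derive; rewrite /GRing.scale/=; ring.
Qed.

Lemma edge_solution_flux_homo (R : realType) (lam L : R) (u u1 : R -> R) :
  lam <= 0 -> edge_solution lam L u u1 ->
  {in `[0, L] &, {homo (fun x => u x * u1 x) : x y / x <= y}}.
Proof.
move=> lam0 /edge_solution_flux[cw dw].
apply: ger0_derive1_le_cc => // x /dw dwx; first by case: dwx.
rewrite derive1E derive_val subr_ge0 (@le_trans _ _ 0) ?sqr_ge0//.
by rewrite mulr_le0_ge0// sqr_ge0.
Qed.

Lemma edge_solution_flux_le (R : realType) (lam L : R) (u u1 : R -> R) :
  0 <= L -> lam <= 0 -> edge_solution lam L u u1 -> u 0 * u1 0 <= u L * u1 L.
Proof.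
move=> L0 lam0 sol; apply: (edge_solution_flux_homo lam0 sol) => //.
  by rewrite in_itv/= lexx.
by rewrite in_itv/= lexx andbT.
Qed.

(** A monotone flux with equal end values is constant, so the two nonnegative terms [u1 ^+ 2] and
    [- lam * u ^+ 2] of its derivative both vanish inside the edge. *)
Lemma edge_solution_flux_eq (R : realType) (lam L : R) (u u1 : R -> R) :
  0 < L -> lam <= 0 -> edge_solution lam L u u1 -> u 0 * u1 0 = u L * u1 L ->
  (forall x, 0 <= x <= L -> u x = u 0) /\ (lam < 0 -> u 0 = 0).
Proof.
move=> L0 lam0 sol wE.
have [cw dw] := edge_solution_flux sol.
have mono := edge_solution_flux_homo lam0 sol.
have wcst x : x \in `[0, L] -> u x * u1 x = u 0 * u1 0.
  move=> /[dup] xin; rewrite in_itv/= => /andP[x0 xL]; apply/eqP.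
  rewrite eq_le {1}wE; apply/andP; split; apply: mono => //.
    by rewrite in_itv/= lexx ltW.
  by rewrite in_itv/= lexx ltW.
have d0 x : x \in `]0, L[ -> u1 x ^+ 2 - lam * u x ^+ 2 = 0.
  move=> xin; have dwx := dw x xin.
  rewrite -(@derive_val _ _ _ _ _ _ _ dwx).
  rewrite (@near_eq_derive _ _ _ _ (cst (u 0 * u1 0))) ?derive_cst//.
  apply: filterS (near_in_itvoo xin) => y yin; apply: wcst.
  exact: subset_itv_oo_cc yin.
have sq0 x : x \in `]0, L[ -> u1 x = 0 /\ (lam < 0 -> u x = 0).
  move=> /d0/eqP; rewrite -mulNr paddr_eq0 ?sqr_ge0//; last first.
    by rewrite mulr_ge0 ?sqr_ge0// oppr_ge0.
  rewrite sqrf_eq0 mulf_eq0 sqrf_eq0 oppr_eq0 => /andP[/eqP -> /orP[/eqP lamE|/eqP -> //]].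
  by rewrite lamE ltxx.
have ucst : forall y, 0 <= y <= L -> u y = u 0.
  case: sol => cu _ du _.
  by apply: (is_derive0_cst_cc cu du) => t /sq0[].
(* Vanishing is known only inside the edge; constancy carries it from the midpoint to the end. *)
split=> // lamlt; have half : 0 < L / 2 < L by apply/andP; split; lra.
rewrite -(ucst (L / 2)); last by case/andP: half => /ltW -> /ltW ->.
by apply: (proj2 (sq0 _ _)).
Qed.

(** * Eigenspaces of a metric graph *)

Lemma pt0 (R : realType) (G : metricGraph R) (e : edge G) :
  pt e 0 = vpt (src e).
Proof. by rewrite /pt lexx. Qed.

Lemma pt_len (R : realType) (G : metricGraph R) (e : edge G) :
  pt e (len e) = vpt (tgt e).
Proof. by rewrite /pt leNgt len_gt0 insubF// ltxx andbF. Qed.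

Lemma pt_inner (R : realType) (G : metricGraph R) (e : edge G) (x : R)
    (xe : 0 < x < len e) :
  pt e x = inr (Tagged (fun e => {x : R | 0 < x < len e}) (exist _ x xe)).
Proof.
rewrite /pt leNgt; case/andP: (xe) => -> _; rewrite insubT/=.
by congr (inr (Tagged _ _)); apply: val_inj.
Qed.

Lemma pt_surj (R : realType) (G : metricGraph R) (p : mg_point G) :
  exists e x, 0 <= x <= len e /\ p = pt e x.
Proof.
case: p => [v|[e [x xe]]].
  have [e /orP[] /eqP <-] := vertex_incident v.
    by exists e, 0; rewrite lexx ltW ?len_gt0// -[inl _]/(vpt _) pt0.
  by exists e, (len e); rewrite lexx ltW ?len_gt0// -[inl _]/(vpt _) pt_len.
exists e, x; rewrite -pt_inner; split=> //.
by case/andP: xe => /ltW -> /ltW ->.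
Qed.

(** Builds a function on the glued space from vertex values and edge functions; the latter are read
    only at interior coordinates. *)
Definition mg_glue (R : realType) (G : metricGraph R) (T : Type)
    (fv : vertex G -> T) (fe : edge G -> R -> T) (p : mg_point G) : T :=
  match p with inl v => fv v | inr (existT e x) => fe e (val x) end.

Lemma mg_glue_pt (R : realType) (G : metricGraph R) (T : Type)
    (fv : vertex G -> T) (fe : edge G -> R -> T) :
  (forall e, fe e 0 = fv (src e)) -> (forall e, fe e (len e) = fv (tgt e)) ->
  forall e x, 0 <= x <= len e -> mg_glue fv fe (pt e x) = fe e x.
Proof.
move=> fe0 feL e x /andP[]; rewrite le_eqVlt => /predU1P[<- _|x0].
  by rewrite pt0/= fe0.
rewrite le_eqVlt => /predU1P[->|xL]; first by rewrite pt_len/= feL.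
by rewrite pt_inner ?x0// => xe.
Qed.

Lemma eigenspace_edge_solution (R : realType) (G : metricGraph R) (lam : R)
    (f : mg_point G -> R) :
  mg_eigenspace lam f -> exists2 f1 : edge G -> R -> R, kirchhoff f1 &
    forall e, edge_solution lam (len e) (fun x => f (pt e x)) (f1 e).
Proof.
move=> [f1 [f2 [H2 kir ae2]]]; exists f1 => // e.
exact: (H2_edge_solution (ltW (len_gt0 e)) (H2 e) (ae2 e)).
Qed.

(** Criterion for explicit eigenfunctions: edge formulas that solve the equation on the whole line
    leave only Kirchhoff's conditions to check. *)
Lemma mem_eigenspace (R : realType) (G : metricGraph R) (lam : R)
    (f : mg_point G -> R) (v v1 : edge G -> R -> R) :
  (forall e x, 0 <= x <= len e -> f (pt e x) = v e x) ->
  (forall e (t : R), is_derive t 1 (v e) (v1 e t)) ->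
  (forall e (t : R), is_derive t 1 (v1 e) (- lam * v e t)) ->
  kirchhoff v1 -> mg_eigenspace lam f.
Proof.
move=> fv dv dv1 kir; exists v1, (fun e x => - lam * v e x); split=> // e.
  by apply: edge_solution_H2 => //; [exact: fv|exact/ltW/len_gt0].
by apply: aeW => x /fv ->; rewrite mulNr opprK.
Qed.

(* Grouped by vertices, the boundary terms are multiples of Kirchhoff sums. *)
Lemma kirchhoff_flux (R : realType) (G : metricGraph R)
    (f : mg_point G -> R) (f1 : edge G -> R -> R) : kirchhoff f1 ->
  \sum_e (f (pt e (len e)) * f1 e (len e) - f (pt e 0) * f1 e 0) = 0.
Proof.
move=> kir; rewrite sumrB.
rewrite (partition_big (@tgt R G) xpredT)//= [X in _ - X](partition_big (@src R G) xpredT)//=.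
rewrite -sumrB big1// => w _.
rewrite (eq_bigr (fun e => f (vpt w) * f1 e (len e))); last first.
  by move=> e /eqP <-; rewrite pt_len.
rewrite [X in _ - X](eq_bigr (fun e => f (vpt w) * f1 e 0)); last first.
  by move=> e /eqP <-; rewrite pt0.
by rewrite -!mulr_sumr -mulrBr kir mulr0.
Qed.

Lemma eigenspace_le0 (R : realType) (G : metricGraph R) (lam : R)
    (f : mg_point G -> R) : lam <= 0 -> mg_eigenspace lam f ->
  (forall e x, 0 <= x <= len e -> f (pt e x) = f (vpt (src e))) /\
  (lam < 0 -> forall p, f p = 0).
Proof.
move=> lam0 /eigenspace_edge_solution[f1 kir sol].
have flux_ge0 e : 0 <= f (pt e (len e)) * f1 e (len e) - f (pt e 0) * f1 e 0.
  rewrite subr_ge0.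
  exact: (edge_solution_flux_le (ltW (len_gt0 e)) lam0 (sol e)).
have flux0 e : f (pt e 0) * f1 e 0 = f (pt e (len e)) * f1 e (len e).
  apply/esym/eqP; rewrite -subr_eq0; apply/eqP.
  (* Nonnegative increments with zero sum all vanish. *)
  have /eqP := kirchhoff_flux f kir.
  by rewrite psumr_eq0// => /allP/(_ e (mem_index_enum e))/eqP.
split=> [e x xe|lamlt p].
  rewrite -pt0.
  exact: (edge_solution_flux_eq (len_gt0 e) lam0 (sol e) (flux0 e)).1.
have [e [x [xe ->]]] := pt_surj p.
have [-> // f0] := edge_solution_flux_eq (len_gt0 e) lam0 (sol e) (flux0 e).
exact: f0.
Qed.

Lemma multiplicity0 (R : realType) (G : metricGraph R) (lam : R) :
  (forall f : mg_point G -> R, mg_eigenspace lam f -> forall p, f p = 0) ->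
  multiplicity G lam 0.
Proof.
move=> triv; exists (fun _ _ => 0); split; [by case|by move=> c _ []|].
by move=> f /triv f0; exists (fun=> 0) => p; rewrite big_ord0 f0.
Qed.

Lemma multiplicity1 (R : realType) (G : metricGraph R) (lam : R)
    (f : mg_point G -> R) (p : mg_point G) :
  mg_eigenspace lam f -> f p != 0 ->
  (forall h, mg_eigenspace lam h -> exists c, forall q, h q = c * f q) ->
  multiplicity G lam 1.
Proof.
move=> ff fp span; exists (fun=> f); split=> // [c c0 i|h /span[c hc]].
  have := c0 p; rewrite big_ord1 => /eqP; rewrite mulf_eq0 (negPf fp) orbF.
  by rewrite (ord1 i) => /eqP.
by exists (fun=> c) => q; rewrite big_ord1.
Qed.

Lemma multiplicity_lt0 (R : realType) (G : metricGraph R) (lam : R) :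
  lam < 0 -> multiplicity G lam 0.
Proof.
by move=> lam0; apply: multiplicity0 => f /(eigenspace_le0 (ltW lam0))[_]; exact.
Qed.

(** A function in the kernel is constant on each edge, hence equal at adjacent vertices, and
    connectedness propagates the value. *)
Lemma multiplicity_0_connected (R : realType) (G : metricGraph R)
    (v : vertex G) : connected_graph G -> multiplicity G 0 1.
Proof.
move=> conn; apply: (@multiplicity1 _ _ _ (fun=> 1) (vpt v)) => [||h /(eigenspace_le0 (lexx _))[hE _]].
- apply: (@mem_eigenspace _ _ _ _ (fun _ _ => 1) (fun _ _ => 0)) => //.
  + by move=> e t; rewrite oppr0 mul0r; exact: is_derive_cst.
  + by move=> w; rewrite !big1 ?subrr.
- exact: oner_neq0.
have stepE a b : [exists e : edge G, ((src e == a) && (tgt e == b))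
    || ((src e == b) && (tgt e == a))] -> h (vpt a) = h (vpt b).
  move=> /existsP[e /orP[] /andP[/eqP <- /eqP <-]];
    by rewrite -pt_len hE// lexx ltW// len_gt0.
have hv w : h (vpt w) = h (vpt v).
  case/connectP: (conn v w) => s; elim: s v {conn hE} => [|a s IHs] u /=.
    by move=> _ ->.
  by case/andP => /stepE -> /IHs sE /sE.
exists (h (vpt v)) => q; have [e [x [xe ->]]] := pt_surj q.
by rewrite hE// hv mulr1.
Qed.

(** * Walks, distances and cycles *)

Lemma walk_edge (R : realType) (G : metricGraph R) (e : edge G) (x y : R) :
  0 <= x <= len e -> 0 <= y <= len e -> walk (pt e x) (pt e y) `|x - y|.
Proof. by move=> xe ye; rewrite -[`|_|]addr0; apply: walk_cons => //; exact: walk_nil. Qed.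

Lemma walk_trans (R : realType) (G : metricGraph R) (p q r : mg_point G) (L M : R) :
  walk p q L -> walk q r M -> walk p r (L + M).
Proof.
move=> pq; elim: pq M => [s|e x y s K xe ye _ IHw] M; first by rewrite add0r.
by move=> /IHw w; rewrite -addrA; exact: walk_cons.
Qed.

Lemma walk_sym (R : realType) (G : metricGraph R) (p q : mg_point G) (L : R) :
  walk p q L -> walk q p L.
Proof.
elim=> [s|e x y s K xe ye _ IHw]; first exact: walk_nil.
by rewrite addrC distrC; apply: walk_trans IHw _; exact: walk_edge.
Qed.

Lemma mg_dist_sym (R : realType) (G : metricGraph R) (p q : mg_point G) :
  mg_dist p q = mg_dist q p.
Proof.
by congr (ereal_inf (image _ _)); apply/seteqP; split=> L /walk_sym.
Qed.

Lemma mg_dist_le (R : realType) (G : metricGraph R) (p q : mg_point G) (L : R) :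
  walk p q L -> (mg_dist p q <= L%:E)%E.
Proof. by move=> w; apply: ereal_inf_lbound; exists L. Qed.

Definition short_map (R : realType) (G : metricGraph R) (phi : mg_point G -> R) : Prop :=
  forall e x y, 0 <= x <= len e -> 0 <= y <= len e ->
    `|phi (pt e x) - phi (pt e y)| <= `|x - y|.

(** Each move of a walk stays in one closed edge, so a bound per edge and the triangle inequality
    control the whole walk. *)
Lemma mg_dist_ge (R : realType) (G : metricGraph R) (phi : mg_point G -> R)
    (p q : mg_point G) :
  short_map phi -> (`|phi p - phi q|%:E <= mg_dist p q)%E.
Proof.
move=> sphi; apply: le_ereal_inf_tmp => _ [L + <-]; rewrite lee_fin.
elim=> [s|e x y s K xe ye _ IHw]; first by rewrite subrr normr0.
rewrite -(subrKA (phi (pt e y))) (le_trans (ler_normD _ _))// lerD//.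
exact: sphi.
Qed.

(* Only meaningful if [h (tgt e) = h (src e) + a e * len e] for all [e]. *)
Definition potential (R : realType) (G : metricGraph R) (h : vertex G -> R)
    (a : edge G -> R) : mg_point G -> R :=
  mg_glue h (fun e x => h (src e) + a e * x).

Lemma potential_pt (R : realType) (G : metricGraph R) (h : vertex G -> R)
    (a : edge G -> R) :
  (forall e, h (tgt e) = h (src e) + a e * len e) ->
  forall e x, 0 <= x <= len e -> potential h a (pt e x) = h (src e) + a e * x.
Proof.
move=> ha; apply: mg_glue_pt => e //=; by rewrite ?mulr0 ?addr0.
Qed.

Lemma short_potential (R : realType) (G : metricGraph R) (h : vertex G -> R)
    (a : edge G -> R) :
  (forall e, h (tgt e) = h (src e) + a e * len e) ->
  (forall e, `|a e| <= 1) -> short_map (potential h a).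
Proof.
move=> ha a1 e x y xe ye; rewrite !potential_pt// opprD addrACA subrr add0r.
by rewrite -mulrBr normrM ler_piMl.
Qed.

(* A simple cycle that descends once keeps descending, since the only other
   edges at the head of a descending arc lead further down. *)
Lemma rooted_acyclic (R : realType) (G : metricGraph R) (d : vertex G -> nat) :
  (forall e : edge G, d (tgt e) = (d (src e)).+1) -> injective (@tgt R G) ->
  forall c : seq (edge G * bool), ~~ graph_cycle c.
Proof.
move=> dE tgt_inj c; apply/negP => /and4P[c0 cyc uq _].
pose adj := fun a b : edge G * bool => arc_to a == arc_from b.
have down (a : edge G * bool) (s : seq (edge G * bool)) : a.2 -> path adj a s -> uniq (map fst (a :: s)) ->
    (last a s).2 /\ d (arc_from (last a s)) = (d (arc_from a) + size s)%N.
  elim: s a => [|b s IHs] a aT; first by rewrite /= addn0.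
  rewrite /= => /andP[/eqP ab pth]; rewrite inE negb_or => /andP[/andP[ab1 _] us].
  (* If [b] were traversed upwards it would share its target with [a], hence be the same edge,
     against [uniq]. *)
  have bT : b.2.
    move: ab ab1; rewrite /arc_to /arc_from aT; case: b.2 => // /tgt_inj ->.
    by rewrite eqxx.
  have [lT ->] := IHs b bT pth us; split=> //.
  by rewrite -ab /arc_to /arc_from aT dE addSnnS.
have up (a : edge G * bool) (s : seq (edge G * bool)) : ~~ has snd (a :: s) -> path adj a s ->
    d (arc_from a) = (d (arc_from (last a s)) + size s)%N.
  elim: s a => [|b s IHs] a; first by rewrite addn0.
  rewrite [has _ _]/= negb_or => /andP[aF hs] /= /andP[/eqP ab pth].
  rewrite addnS -(IHs b)//.
  by rewrite -ab /arc_to /arc_from (negPf aF) dE.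
have [/hasP[a ac aT]|noup] := boolP (has snd c).
  (* Rotate the cycle to start with a descending arc: once around, the depth has grown by the length
     of the cycle and yet is unchanged. *)
  have [i s rotE] := rot_to ac.
  move: cyc uq; rewrite -(rot_cycle i) -(rot_uniq i) -map_rot rotE /=.
  rewrite rcons_path => /andP[pth /eqP la] us.
  have [lT lE] := down a s aT pth us.
  move: la lE; rewrite {1}/arc_to lT => <-.
  by rewrite [X in d X]/arc_from lT dE; lia.
(* Otherwise every arc ascends, and the depth strictly drops once around. *)
case: c c0 cyc noup {uq} => // a s _.
rewrite [cycle _ _]/= rcons_path => /andP[pth /eqP la] noup.
have lF : ~~ (last a s).2.
  by apply: contra noup => lT; apply/hasP; exists (last a s) => //; exact: mem_last.
have := up a s noup pth; rewrite -la /arc_to /arc_from (negPf lF) dE; lia.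
Qed.

(** * The tree Gamma and its diameter *)

Definition gdepth (v : gvertex) : nat :=
  match v with v_0 => 0 | v_l | v_r | w_u | w_d => 1 | _ => 2 end.

Lemma Gamma_connected (R : realType) (eps : R) (heps : 0 < eps < 2^-1) :
  connected_graph (Gamma heps).
Proof.
set adj := (fun a b : gvertex => [exists e : gedge,
  ((gsrc e == a) && (gtgt e == b)) || ((gsrc e == b) && (gtgt e == a))]).
have adj_sym : connect_sym adj.
  by apply: sym_connect_sym => a b; apply: eq_existsb => e; rewrite orbC.
have edgeP e : connect adj (gsrc e) (gtgt e).
  by apply: connect1; apply/existsP; exists e; rewrite !eqxx.
have root v : connect adj v_0 v.
  case: v; [exact: connect0|exact: (edgeP e_l)|exact: (edgeP e_r)
    |exact: (edgeP e_u)|exact: (edgeP e_d)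
    |exact: connect_trans (edgeP e_u) (edgeP e_u1)
    |exact: connect_trans (edgeP e_u) (edgeP e_u2)
    |exact: connect_trans (edgeP e_d) (edgeP e_d1)
    |exact: connect_trans (edgeP e_d) (edgeP e_d2)].
by move=> u v; apply: (connect_trans _ (root v)); rewrite adj_sym; exact: root.
Qed.

Lemma Gamma_is_tree (R : realType) (eps : R) (heps : 0 < eps < 2^-1) :
  is_tree (Gamma heps).
Proof.
split; first exact: Gamma_connected.
by apply: (@rooted_acyclic _ _ (gdepth : vertex (Gamma heps) -> nat)); [case|case; case].
Qed.

(** The distance from [v_0]. *)
Definition gheight (R : realType) (eps : R) (v : gvertex) : R :=
  match v with
  | v_0 => 0 | v_l | v_r => 1 | w_u | w_d => 2^-1 - eps
  | _ => 2^-1 - eps + (2^-1 - eps)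
  end.

Definition gheight_pt (R : realType) (eps : R) (heps : 0 < eps < 2^-1) :
    mg_point (Gamma heps) -> R :=
  potential (gheight eps : vertex (Gamma heps) -> R) (fun=> 1).

Lemma gheight_ptE (R : realType) (eps : R) (heps : 0 < eps < 2^-1)
    (e : edge (Gamma heps)) (x : R) : 0 <= x <= len e ->
  gheight_pt (pt e x) = gheight eps (gsrc e) + x.
Proof.
move=> xe; rewrite /gheight_pt potential_pt// ?mul1r//.
by case; rewrite /= ?add0r mul1r.
Qed.

(* The distance from the end [v_l] (for [b = false]) or [v_r] of the diameter. *)
Definition gend_dist (R : realType) (eps : R) (b : bool) (v : gvertex) : R :=
  match v with
  | v_l => b%:R * 2 | v_r => (~~ b)%:R * 2 | _ => 1 + gheight eps v
  end.

Definition gend_slope (R : realType) (b : bool) (e : gedge) : R :=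
  match e with e_l => (-1) ^+ (~~ b) | e_r => (-1) ^+ b | _ => 1 end.

Definition gend_dist_pt (R : realType) (eps : R) (heps : 0 < eps < 2^-1) (b : bool) :
    mg_point (Gamma heps) -> R :=
  potential (gend_dist eps b : vertex (Gamma heps) -> R)
    (gend_slope R b : edge (Gamma heps) -> R).

Lemma gend_distE (R : realType) (eps : R) (heps : 0 < eps < 2^-1) (b : bool)
    (e : edge (Gamma heps)) :
  gend_dist eps b (tgt e) = gend_dist eps b (src e) + gend_slope R b e * len e.
Proof. by case: e; case: b => /=; lra. Qed.

Lemma short_gend_dist (R : realType) (eps : R) (heps : 0 < eps < 2^-1) (b : bool) :
  short_map (@gend_dist_pt R eps heps b).
Proof.
apply: short_potential; first exact: gend_distE.
by case; case: b; rewrite /= ?normrX ?normrN1 ?normr1.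
Qed.

Lemma gend_dist_ptE (R : realType) (eps : R) (heps : 0 < eps < 2^-1) (b : bool)
    (e : edge (Gamma heps)) (x : R) : 0 <= x <= len e ->
  gend_dist_pt b (pt e x) = gend_dist eps b (gsrc e) + gend_slope R b e * x.
Proof. by move=> xe; rewrite /gend_dist_pt potential_pt//; exact: gend_distE. Qed.

Lemma gend_dist_gpt (R : realType) (eps : R) (heps : 0 < eps < 2^-1) (b : bool)
    (v : gvertex) : gend_dist_pt b (gpt heps v) = gend_dist eps b v.
Proof. by []. Qed.

Lemma walk_down (R : realType) (eps : R) (heps : 0 < eps < 2^-1)
    (p : mg_point (Gamma heps)) : walk (gpt heps v_0) p (gheight_pt p).
Proof.
have edge_walk (e : edge (Gamma heps)) x : 0 <= x <= len e ->
    walk (gpt heps (gsrc e)) (pt e x) x.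
  move=> /[dup] xe /andP[x0 _]; rewrite -{2}[x]ger0_norm// -normrN -sub0r.
  rewrite -[gpt _ _](@pt0 _ (Gamma heps)); apply: walk_edge => //.
  by rewrite lexx ltW ?len_gt0.
have src_walk (e : edge (Gamma heps)) : gsrc e = v_0 ->
    walk (gpt heps v_0) (gpt heps (gtgt e)) (len e).
  move=> e0; rewrite -[gpt _ (gtgt e)](@pt_len _ (Gamma heps)) -{1}e0.
  by apply: edge_walk; rewrite lexx ltW ?len_gt0.
have [e [x [xe ->]]] := pt_surj p.
rewrite gheight_ptE//; apply: (walk_trans _ (edge_walk e x xe)).
have w0 : walk (gpt heps v_0) (gpt heps v_0) 0 by exact: walk_nil.
(* Edges starting at [v_0] need the empty walk; the leaf edges of [S2] are reached through [w_u] or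
   [w_d]. *)
case: e xe => //= _; first [exact: (src_walk e_u)|exact: (src_walk e_d)].
Qed.

Lemma mg_dist_le_gheight (R : realType) (eps : R) (heps : 0 < eps < 2^-1)
    (p q : mg_point (Gamma heps)) :
  (mg_dist p q <= (gheight_pt p + gheight_pt q)%:E)%E.
Proof.
by apply: mg_dist_le; apply: walk_trans (walk_sym _) _; exact: walk_down.
Qed.

Lemma gheight_pt_le1 (R : realType) (eps : R) (heps : 0 < eps < 2^-1)
    (p : mg_point (Gamma heps)) :
  gheight_pt p <= 1 /\ (1 <= gheight_pt p -> p = gpt heps v_l \/ p = gpt heps v_r).
Proof.
have [e [x [xe ->]]] := pt_surj p.
rewrite gheight_ptE//; case/andP: (heps) => eps0 epslt.
case: e xe => /= /andP[x0 xl]; (split; first lra) => x1; try (exfalso; lra).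
- left; have -> : x = @len _ (Gamma heps) e_l by rewrite /=; lra.
  exact: pt_len.
- right; have -> : x = @len _ (Gamma heps) e_r by rewrite /=; lra.
  exact: pt_len.
Qed.

Lemma mg_dist_le2 (R : realType) (eps : R) (heps : 0 < eps < 2^-1)
    (p q : mg_point (Gamma heps)) : (mg_dist p q <= 2%:E)%E.
Proof.
apply: le_trans (mg_dist_le_gheight p q) _; rewrite lee_fin.
by have [+ _] := gheight_pt_le1 p; have [+ _] := gheight_pt_le1 q; lra.
Qed.

Lemma mg_dist_ends (R : realType) (eps : R) (heps : 0 < eps < 2^-1) :
  mg_dist (gpt heps v_l) (gpt heps v_r) = 2%:E.
Proof.
apply/eqP; rewrite eq_le mg_dist_le2/=.
have := mg_dist_ge (gpt heps v_l) (gpt heps v_r) (@short_gend_dist _ _ heps false).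
by rewrite !gend_dist_gpt/= mul0r sub0r mul1r normrN ger0_norm.
Qed.

Lemma mg_diam_Gamma (R : realType) (eps : R) (heps : 0 < eps < 2^-1) :
  mg_diam (Gamma heps) = 2%:E.
Proof.
apply/eqP; rewrite eq_le; apply/andP; split.
  by apply: ge_ereal_sup => _ [p [q ->]]; exact: mg_dist_le2.
by apply: ereal_sup_ubound; exists (gpt heps v_l), (gpt heps v_r); rewrite mg_dist_ends.
Qed.

Lemma mg_dist_diam (R : realType) (eps : R) (heps : 0 < eps < 2^-1)
    (p q : mg_point (Gamma heps)) :
  mg_dist p q = mg_diam (Gamma heps) <->
    (p = gpt heps v_l /\ q = gpt heps v_r) \/
    (p = gpt heps v_r /\ q = gpt heps v_l).
Proof.
rewrite mg_diam_Gamma; split=> [pq2|[] [-> ->]]; last 2 first.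
- exact: mg_dist_ends.
- by rewrite mg_dist_sym mg_dist_ends.
have [p1 pE] := gheight_pt_le1 p; have [q1 qE] := gheight_pt_le1 q.
have := mg_dist_le_gheight p q; rewrite pq2 lee_fin => h2.
have {}pE : p = gpt heps v_l \/ p = gpt heps v_r by apply: pE; lra.
have {}qE : q = gpt heps v_l \/ q = gpt heps v_r by apply: qE; lra.
(* Both points are ends of the diameter; they differ because the empty walk gives distance at most 0
   from a point to itself. *)
have pq : p <> q.
  move=> pqE; have := mg_dist_le (walk_nil p).
  by rewrite {2}pqE pq2 lee_fin leNgt ltr0n.
by case: pE qE pq => -> [] ->; first [by []|by left|by right].
Qed.

(** Arc length measured from [v_l]: both long edges have coordinate 0 at [v_0], so [e_l] is run
    backwards and [v_0] is passed at [s = 1]. *)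
Definition ggeodesic (R : realType) (eps : R) (heps : 0 < eps < 2^-1) (s : R) :
    mg_point (Gamma heps) :=
  if s <= 1 then @pt R (Gamma heps) e_l (1 - s)
  else @pt R (Gamma heps) e_r (s - 1).

(** The lower bound holds because the distance to [v_l] equals [s] at parameter [s]; the upper bound
    is the walk along the path, broken at [v_0] when [s <= 1 < t]. *)
Lemma ggeodesic_dist (R : realType) (eps : R) (heps : 0 < eps < 2^-1) (s t : R) :
  0 <= s <= 2 -> 0 <= t <= 2 ->
  mg_dist (ggeodesic heps s) (ggeodesic heps t) = `|s - t|%:E.
Proof.
wlog st : s t / s <= t => [wl s2 t2|/andP[s0 s2] /andP[t0 t2]].
  by case: (leP s t) => [|/ltW] st; [|rewrite mg_dist_sym distrC]; exact: wl.
have endE r : 0 <= r <= 2 -> gend_dist_pt false (ggeodesic heps r) = r.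
  move=> /andP[r0 r2]; rewrite /ggeodesic; case: leP => r1.
    rewrite gend_dist_ptE/=; last by apply/andP; split; lra.
    by rewrite expr1; lra.
  rewrite gend_dist_ptE/=; last by apply/andP; split; lra.
  by lra.
apply/eqP; rewrite eq_le; apply/andP; split; last first.
  have := mg_dist_ge (ggeodesic heps s) (ggeodesic heps t)
    (@short_gend_dist _ _ heps false).
  by rewrite !endE ?s0 ?t0.
apply: mg_dist_le; rewrite /ggeodesic; case: (leP s 1) => s1.
  have w1 : walk (@pt R (Gamma heps) e_l (1 - s)) (gpt heps v_0) (1 - s).
    rewrite -[gpt _ _](@pt0 _ (Gamma heps) e_l).
    rewrite -[X in walk _ _ X]ger0_norm ?subr_ge0// -[X in `|X|]subr0.
    by apply: walk_edge => /=; apply/andP; split; lra.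
  case: (leP t 1) => t1.
    rewrite distrC (_ : t - s = (1 - s) - (1 - t)); last by lra.
    by apply: walk_edge; apply/andP; rewrite /=; split; lra.
  rewrite distrC ger0_norm ?subr_ge0// (_ : t - s = (1 - s) + (t - 1)); last by lra.
  apply: walk_trans w1 _.
  rewrite -[gpt _ _](@pt0 _ (Gamma heps) e_r).
  rewrite -[X in walk _ _ X]ger0_norm; last by lra.
  rewrite -normrN -[X in `|X|]sub0r.
  by apply: walk_edge => /=; apply/andP; split; lra.
rewrite leNgt (lt_le_trans s1 st)/= (_ : s - t = (s - 1) - (t - 1)); last by lra.
by apply: walk_edge => /=; apply/andP; split; lra.
Qed.

Lemma ggeodesic_image (R : realType) (eps : R) (heps : 0 < eps < 2^-1) :
  P2 heps = ggeodesic heps @` `[0, 2].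
Proof.
apply/seteqP; split=> [_ [e eD [x + <-]]|_ [s + <-]]; rewrite /= in_itv/=.
  case: eD => -> /= /andP[x0 x1].
    exists (1 - x).
      by rewrite /= in_itv/=; apply/andP; split; lra.
    by rewrite /ggeodesic lerBlDr lerDl x0 subKr.
  exists (1 + x).
    by rewrite /= in_itv/=; apply/andP; split; lra.
  (* The point [x = 0] of [e_r] is [v_0], which [ggeodesic] represents on [e_l]. *)
  rewrite /ggeodesic gerDl; case: leP => xle; last by rewrite addrAC subrr add0r.
  have -> : x = 0 by lra.
  by rewrite addr0 subrr !pt0.
move=> /andP[s0 s2]; rewrite /ggeodesic; case: leP => s1.
  by exists e_l; [left|exists (1 - s)] => //; rewrite /= in_itv/=; apply/andP; split; lra.
by exists e_r; [right|exists (s - 1)] => //; rewrite /= in_itv/=; apply/andP; split; lra.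
Qed.

(* Off the diameter path, the distances to its two ends add up to more than 2. *)
Lemma ggeodesic_unique (R : realType) (eps : R) (heps : 0 < eps < 2^-1)
    (p : mg_point (Gamma heps)) (s : R) :
  (mg_dist (gpt heps v_l) p <= s%:E)%E ->
  (mg_dist p (gpt heps v_r) <= (2 - s)%:E)%E -> p = ggeodesic heps s.
Proof.
have [e [x [xe ->]]] := pt_surj p.
move=> /(le_trans (mg_dist_ge _ _ (@short_gend_dist _ _ heps false))).
rewrite gend_dist_gpt gend_dist_ptE// lee_fin/= mul0r sub0r normrN => hl.
move=> /(le_trans (mg_dist_ge _ _ (@short_gend_dist _ _ heps true))).
rewrite gend_dist_gpt gend_dist_ptE// lee_fin/= mul0r subr0 => hr.
have {}hl := le_trans (ler_norm _) hl.
have {}hr := le_trans (ler_norm _) hr.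
case/andP: (heps) => eps0 epslt.
have vE : gpt heps v_0 = ggeodesic heps 1.
  by rewrite /ggeodesic lexx subrr pt0.
(* Adding the two bounds excludes the leaf edges of [S2] and forces [x = 0], that is [v_0], on [e_u]
   and [e_d]. *)
case: e xe hl hr => /= /andP[x0 xl] hl hr; try (exfalso; lra).
- have -> : s = 1 - x by lra.
  by rewrite /ggeodesic lerBlDr lerDl x0 subKr.
- have -> : s = 1 + x by lra.
  rewrite /ggeodesic gerDl; case: leP => xle; last by rewrite addrAC subrr add0r.
  have -> : x = 0 by lra.
  by rewrite addr0 subrr !pt0.
- have -> : x = 0 by lra.
  have -> : s = 1 by lra.
  by rewrite -vE pt0.
- have -> : x = 0 by lra.
  have -> : s = 1 by lra.
  by rewrite -vE pt0.
Qed.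

(** A shortest path has length 2, and its point at parameter [s] lies at distance [s] from [v_l] and
    [2 - s] from [v_r], which determines it. *)
Lemma shortest_path_ends (R : realType) (eps : R) (heps : 0 < eps < 2^-1)
    (P : set (mg_point (Gamma heps))) :
  shortest_path (gpt heps v_l) (gpt heps v_r) P <-> P = P2 heps.
Proof.
have g0 : ggeodesic heps 0 = gpt heps v_l.
  by rewrite /ggeodesic ler01 subr0 (@pt_len _ (Gamma heps) e_l).
have g2 : ggeodesic heps 2 = gpt heps v_r.
  rewrite /ggeodesic leNgt ltr1n/= (_ : 2 - 1 = 1); last by lra.
  by rewrite (@pt_len _ (Gamma heps) e_r).
split=> [[L [gamma [L0 gl gr gdist ->]]]|->]; last first.
  exists 2, (ggeodesic heps); split=> //; last exact: ggeodesic_image.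
  exact: ggeodesic_dist.
have L2 : L = 2.
  have := gdist 0 L; rewrite lexx L0 lexx gl gr mg_dist_ends sub0r normrN ger0_norm//.
  by move=> /(_ isT isT)[].
rewrite ggeodesic_image; subst L.
apply: eq_imagel => s; rewrite /= in_itv/= => /[dup] s2 /andP[sge sle].
apply: ggeodesic_unique.
  by rewrite -gl gdist ?lexx ?ler0n// sub0r normrN ger0_norm.
by rewrite -gr gdist ?lexx ?ler0n// distrC ger0_norm ?subr_ge0.
Qed.

(** * The spectrum of Gamma below mu_2 *)

(** Expansion from the target end, where all leaves of [Gamma] lie: a Neumann condition there
    removes one term from each formula. *)
Lemma edge_solution_trig_tgt (R : realType) (k L : R) (u u1 : R -> R) :
  k != 0 -> edge_solution (k ^+ 2) L u u1 -> forall x, 0 <= x <= L ->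
  u x = u L * cos (k * (L - x)) - u1 L / k * sin (k * (L - x)) /\
  u1 x = u1 L * cos (k * (L - x)) + k * u L * sin (k * (L - x)).
Proof.
move=> k0 sol x xL.
have LL : 0 <= L <= L by case/andP: xL => x0 xl; rewrite lexx (le_trans x0).
have [-> ->] := edge_solution_trig k0 sol xL.
have [-> ->] := edge_solution_trig k0 sol LL.
rewrite mulrBr cosB sinB.
have := cos2Dsin2 (k * L); set C := cos (k * L); set S := sin (k * L) => CS.
set c := cos _; set s := sin _.
split; rewrite -[LHS]mulr1 -CS; field; exact: k0.
Qed.

(** Exposes the concrete list of edges so that Kirchhoff sums can be unfolded term by term. *)
Lemma big_gedge (R : zmodType) (P : pred gedge) (F : gedge -> R) :
  \sum_(e | P e) F e = \sum_(e <- gedge_enum | P e) F e.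
Proof. by rewrite [index_enum _]unlock Finite.enum.unlock. Qed.

Lemma gkirchhoffP (R : realType) (eps : R) (heps : 0 < eps < 2^-1)
    (f1 : edge (Gamma heps) -> R -> R) :
  kirchhoff f1 <->
  [/\ f1 e_l 0 + f1 e_r 0 + f1 e_u 0 + f1 e_d 0 = 0,
      f1 e_u (2^-1 - eps) = f1 e_u1 0 + f1 e_u2 0,
      f1 e_d (2^-1 - eps) = f1 e_d1 0 + f1 e_d2 0,
      f1 e_l 1 = 0 /\ f1 e_r 1 = 0
    & [/\ f1 e_u1 (2^-1 - eps) = 0, f1 e_u2 (2^-1 - eps) = 0,
          f1 e_d1 (2^-1 - eps) = 0 & f1 e_d2 (2^-1 - eps) = 0]].
Proof.
pose bal (v : gvertex) := match v with
  | v_0 => - (f1 e_l 0 + f1 e_r 0 + f1 e_u 0 + f1 e_d 0)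
  | v_l => f1 e_l 1 | v_r => f1 e_r 1
  | w_u => f1 e_u (2^-1 - eps) - (f1 e_u1 0 + f1 e_u2 0)
  | w_d => f1 e_d (2^-1 - eps) - (f1 e_d1 0 + f1 e_d2 0)
  | v_u1 => f1 e_u1 (2^-1 - eps) | v_u2 => f1 e_u2 (2^-1 - eps)
  | v_d1 => f1 e_d1 (2^-1 - eps) | v_d2 => f1 e_d2 (2^-1 - eps)
  end.
have balE (v : vertex (Gamma heps)) :
    \sum_(e | tgt e == v) f1 e (len e) - \sum_(e | src e == v) f1 e 0 = bal v.
  by rewrite !big_gedge; case: v; rewrite /gedge_enum !big_cons !big_nil /=; ring.
split=> [kir|[h0 hu hd [hl hr] [hu1 hu2 hd1 hd2]] v].
  have K (v : gvertex) : bal v = 0 by rewrite -balE; exact: kir.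
  split; [|exact/subr0_eq/(K w_u)|exact/subr0_eq/(K w_d)
    |by split; [exact: (K v_l)|exact: (K v_r)]
    |by split; [exact: (K v_u1)|exact: (K v_u2)|exact: (K v_d1)|exact: (K v_d2)]].
  by apply/eqP; rewrite -oppr_eq0; apply/eqP/(K v_0).
by rewrite balE; case: v => //=; rewrite ?h0 ?hu ?hd ?subrr ?oppr0.
Qed.

(** The cosine is the positive root of [c ^+ 2 = 2 * (1 - c ^+ 2)]. *)
Definition gangle (R : realType) : R := acos (Num.sqrt (2 / 3)).

Lemma sqrt23_itv (R : realType) : -1 <= Num.sqrt (2 / 3 : R) <= 1.
Proof.
rewrite (le_trans _ (sqrtr_ge0 _)) ?lerN10//= -[leRHS]sqrtr1 ler_sqrt ?ltr01//.
by rewrite ler_pdivrMr// mul1r ler_nat.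
Qed.

Lemma cos_gangle (R : realType) : cos (gangle R) = Num.sqrt (2 / 3).
Proof. by apply: acosK; rewrite in_itv/= sqrt23_itv. Qed.

Lemma cos_gangle_gt0 (R : realType) : 0 < cos (gangle R).
Proof. by rewrite cos_gangle sqrtr_gt0 divr_gt0. Qed.

Lemma cos_gangle_sqr (R : realType) : cos (gangle R) ^+ 2 = 2 / 3.
Proof. by rewrite cos_gangle sqr_sqrtr// divr_ge0. Qed.

Lemma gangle_itv (R : realType) : 0 <= gangle R <= pi.
Proof. by rewrite acos_ge0 ?acos_lepi// sqrt23_itv. Qed.

Lemma gangle_gt0 (R : realType) : 0 < gangle R.
Proof.
case/andP: (gangle_itv R); rewrite le_eqVlt => /predU1P[g0|//] _.
by have := cos_gangle_sqr R; rewrite -g0 cos0; lra.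
Qed.

Lemma gangle_lt_pi2 (R : realType) : gangle R < pi / 2.
Proof.
rewrite -ltr_cos ?cos_pihalf ?cos_gangle_gt0// in_itv/= ?gangle_itv//.
by have := pi_gt0 R; move=> ?; apply/andP; split; lra.
Qed.

(** The doubled angle has cosine 1/3, which is positive. The strict inequality leaves room for a
    positive [eps]. *)
Lemma gangle_lt_pi4 (R : realType) : gangle R < pi / 4.
Proof.
suff : gangle R *+ 2 < pi / 2 by lra.
have := gangle_lt_pi2 R; have := gangle_gt0 R; have := pi_gt0 R => ? ? ?.
rewrite -ltr_cos ?in_itv/=; try by apply/andP; split; lra.
by rewrite cos_pihalf cos_mulr2n cos_gangle_sqr; lra.
Qed.

Lemma sin_gangle_sqr (R : realType) : sin (gangle R) ^+ 2 = 1 / 3.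
Proof. by rewrite sin2cos2 cos_gangle_sqr; lra. Qed.

Lemma sin_gangle_gt0 (R : realType) : 0 < sin (gangle R).
Proof.
apply: sin_gt0_pi; rewrite gangle_gt0/=.
by apply: lt_trans (gangle_lt_pi2 R) _; have := pi_gt0 R; lra.
Qed.

Lemma gangle_cos_ge (R : realType) (y : R) : 0 <= y <= gangle R ->
  cos (gangle R) <= cos y ?= iff (y == gangle R).
Proof.
move=> /andP[y0 yg]; have [gpi0 gpi] := andP (gangle_itv R).
have yin : y \in `[0, pi] by rewrite in_itv/= y0 (le_trans yg).
have gin : gangle R \in `[0, pi] by rewrite in_itv/= gpi0.
split; last by rewrite eq_sym; apply/eqP/eqP => [/cos_inj ->//|->].
by rewrite leNgt ltr_cos// -leNgt.
Qed.

Lemma gangle_sin_le (R : realType) (y : R) : 0 <= y <= gangle R ->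
  0 <= sin y <= sin (gangle R).
Proof.
move=> yg; have [y0 yle] := andP yg; have [gpi0 gpi] := andP (gangle_itv R).
have s0 : 0 <= sin y by rewrite sin_ge0_pi// y0 (le_trans yle).
rewrite s0/= -(ler_pXn2r (isT : (0 < 2)%N)) ?nnegrE ?(ltW (sin_gangle_gt0 R))//.
rewrite !sin2cos2 lerD2l lerN2 ler_pXn2r ?nnegrE ?(ltW (cos_gangle_gt0 R))//.
  exact: (gangle_cos_ge yg).1.
exact: le_trans (ltW (cos_gangle_gt0 R)) (gangle_cos_ge yg).1.
Qed.

(* The eigenvalue is the square of this frequency: [k * (2^-1 - eps)] is the
   angle at which [cos^2 = 2 * sin^2], i.e. at which a branch of S2 with Neumann
   ends vanishes at [v_0]. *)
Definition gfreq (R : realType) (eps : R) : R := gangle R / (2^-1 - eps).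

Lemma gfreqE (R : realType) (eps : R) : 0 < eps < 2^-1 ->
  gfreq eps * (2^-1 - eps) = gangle R.
Proof. by case/andP=> _ ?; rewrite divfK// subr_eq0 gt_eqF. Qed.

Lemma gfreq_gt0 (R : realType) (eps : R) : 0 < eps < 2^-1 -> 0 < gfreq eps.
Proof. by case/andP=> _ ?; rewrite divr_gt0 ?gangle_gt0 ?subr_gt0. Qed.

(** The value of [eps] at which [gfreq eps] reaches [pi / 2]. *)
Definition geps0 (R : realType) : R := 2^-1 - gangle R / (pi / 2).

Lemma geps0_gt0 (R : realType) : 0 < geps0 R.
Proof.
have p0 := pi_gt0 R.
rewrite subr_gt0 ltr_pdivrMr ?divr_gt0//.
by have := gangle_lt_pi4 R; lra.
Qed.

Lemma gfreq_lt_pi2 (R : realType) (eps : R) : 0 < eps < 2^-1 -> eps < geps0 R ->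
  gfreq eps < pi / 2.
Proof.
move=> /andP[_ e1]; rewrite /geps0 ltrBrDr -ltrBrDl => e2.
have p0 := pi_gt0 R.
by rewrite ltr_pdivrMr ?subr_gt0// mulrC -ltr_pdivrMr// divr_gt0.
Qed.

(** The first three relations are continuity at [v_0], the fourth is Kirchhoff's condition there.
    The condition on the cosine makes the two leaves of a branch share one value. *)
Lemma gamma_eigen_shape (R : realType) (eps : R) (heps : 0 < eps < 2^-1) (k : R)
    (f : mg_point (Gamma heps) -> R) :
  0 < k -> cos (k * (2^-1 - eps)) != 0 -> mg_eigenspace (k ^+ 2) f ->
  exists a b p q : R,
    let C := cos (k * (2^-1 - eps)) in let S := sin (k * (2^-1 - eps)) in
    let D := C ^+ 2 - 2 * S ^+ 2 in
    [/\ [/\ p * cos k = a * D, q * cos k = a * D, b * D = a * D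
          & 3 * C * S * (a + b) + (p + q) * sin k = 0],
        forall x, 0 <= x <= 1 -> f (@pt R (Gamma heps) e_l x) = p * cos (k * (1 - x)) /\
          f (@pt R (Gamma heps) e_r x) = q * cos (k * (1 - x)),
        forall x, 0 <= x <= 2^-1 - eps ->
          [/\ f (@pt R (Gamma heps) e_u1 x) = a * cos (k * (2^-1 - eps - x)),
              f (@pt R (Gamma heps) e_u2 x) = a * cos (k * (2^-1 - eps - x)),
              f (@pt R (Gamma heps) e_d1 x) = b * cos (k * (2^-1 - eps - x))
            & f (@pt R (Gamma heps) e_d2 x) = b * cos (k * (2^-1 - eps - x))]
      & forall x, 0 <= x <= 2^-1 - eps ->
          f (@pt R (Gamma heps) e_u x) = a * (C * cos (k * (2^-1 - eps - x))
            - 2 * S * sin (k * (2^-1 - eps - x))) /\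
          f (@pt R (Gamma heps) e_d x) = b * (C * cos (k * (2^-1 - eps - x))
            - 2 * S * sin (k * (2^-1 - eps - x)))].
Proof.
move=> k0 C0 /eigenspace_edge_solution[f1 /gkirchhoffP[h0 hu hd [hl hr] [hu1 hu2 hd1 hd2]] sol].
have kn0 : k != 0 by rewrite gt_eqF.
have edge (e : edge (Gamma heps)) x := @edge_solution_trig_tgt R k (len e) _ _ kn0 (sol e) x.
case/andP: (heps) => eps0 epslt.
have l0 : 0 <= (0 : R) <= 2^-1 - eps by rewrite lexx/=; lra.
have i0 : 0 <= (0 : R) <= 1 by rewrite lexx/=.
have leaf (e : gedge) x : f1 e (glen eps e) = 0 -> 0 <= x <= glen eps e ->
    f (@pt R (Gamma heps) e x) = f (gpt heps (gtgt e)) * cos (k * (glen eps e - x)) /\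
    f1 e x = k * f (gpt heps (gtgt e)) * sin (k * (glen eps e - x)).
  move=> f10 xe; have [-> ->] := edge e x xe.
  by rewrite /= f10 (@pt_len R (Gamma heps) e) !mul0r subr0 add0r.
have inner (e : gedge) x : 0 <= x <= glen eps e ->
    f (@pt R (Gamma heps) e x) = f (gpt heps (gtgt e)) * cos (k * (glen eps e - x))
      - f1 e (glen eps e) / k * sin (k * (glen eps e - x)) /\
    f1 e x = f1 e (glen eps e) * cos (k * (glen eps e - x))
      + k * f (gpt heps (gtgt e)) * sin (k * (glen eps e - x)).
  move=> xe; have [-> ->] := edge e x xe.
  by rewrite /= (@pt_len R (Gamma heps) e).
have [wu1 wu1'] := leaf e_u1 0 hu1 l0; have [wu2 wu2'] := leaf e_u2 0 hu2 l0.
have [wd1 wd1'] := leaf e_d1 0 hd1 l0; have [wd2 wd2'] := leaf e_d2 0 hd2 l0.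
have [wl wl'] := leaf e_l 0 hl i0; have [wr wr'] := leaf e_r 0 hr i0.
have [wu wu'] := inner e_u 0 l0; have [wd wd'] := inner e_d 0 l0.
move: wu1 wu1' wu2 wu2' wd1 wd1' wd2 wd2' wl wl' wr wr' wu wu' wd wd'.
rewrite !pt0 /= !subr0 !mulr1.
set C := cos (k * (2^-1 - eps)) in C0 *; set S := sin _.
rewrite -![vpt _]/(gpt heps _).
move=> wu1 wu1' wu2 wu2' wd1 wd1' wd2 wd2' wl wl' wr wr' wu wu' wd wd'.
(* Both leaf edges of a branch give the value at its inner vertex as [C] times the leaf value. *)
have u12 : f (gpt heps v_u2) = f (gpt heps v_u1) by apply: (mulIf C0); rewrite -wu1 -wu2.
have d12 : f (gpt heps v_d2) = f (gpt heps v_d1) by apply: (mulIf C0); rewrite -wd1 -wd2.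
have hu' : f1 e_u (2^-1 - eps) = k * (2 * f (gpt heps v_u1) * S).
  by rewrite hu wu1' wu2' u12; ring.
have hd' : f1 e_d (2^-1 - eps) = k * (2 * f (gpt heps v_d1) * S).
  by rewrite hd wd1' wd2' d12; ring.
have divk y : k * y / k = y by rewrite mulrAC divff// mul1r.
have v0u : f (gpt heps v_0) = f (gpt heps v_u1) * (C ^+ 2 - 2 * S ^+ 2).
  by rewrite wu hu' divk wu1; ring.
have v0d : f (gpt heps v_0) = f (gpt heps v_d1) * (C ^+ 2 - 2 * S ^+ 2).
  by rewrite wd hd' divk wd1; ring.
exists (f (gpt heps v_u1)), (f (gpt heps v_d1)), (f (gpt heps v_l)), (f (gpt heps v_r)).
split.
- rewrite -wl -wr -v0u -v0d; split=> //; apply: (mulfI kn0); rewrite mulr0.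
  by rewrite -h0 wl' wr' wu' wd' hu' hd' wu1 wd1; ring.
- by move=> x x1; have [-> _] := leaf e_l x hl x1; have [-> _] := leaf e_r x hr x1.
- move=> x xl; have [-> _] := leaf e_u1 x hu1 xl; have [-> _] := leaf e_u2 x hu2 xl.
  have [-> _] := leaf e_d1 x hd1 xl; have [-> _] := leaf e_d2 x hd2 xl.
  by rewrite /= u12 d12.
- move=> x xl; have [-> _] := inner e_u x xl; have [-> _] := inner e_d x xl.
  by rewrite /= hu' hd' !divk wu1 wd1; split; ring.
Qed.

Lemma eigenspace_below_gfreq (R : realType) (eps : R) (heps : 0 < eps < 2^-1) (k : R)
    (f : mg_point (Gamma heps) -> R) :
  0 < k < gfreq eps -> k < pi / 2 -> mg_eigenspace (k ^+ 2) f -> forall p, f p = 0.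
Proof.
move=> /andP[k0 kfreq] kpi2 fE.
have l0 : 0 < 2^-1 - eps by case/andP: (heps) => _ ?; rewrite subr_gt0.
have klg : k * (2^-1 - eps) < gangle R by rewrite -(gfreqE heps) ltr_pM2r.
have kl0 : 0 < k * (2^-1 - eps) by rewrite mulr_gt0.
have p0 := pi_gt0 R; have gpi2 := gangle_lt_pi2 R.
have kl : 0 <= k * (2^-1 - eps) <= gangle R by rewrite !ltW.
have Clt : cos (gangle R) < cos (k * (2^-1 - eps)).
  by rewrite lt_neqAle (gangle_cos_ge kl).1 (gangle_cos_ge kl).2 lt_eqF.
have C0 := lt_trans (cos_gangle_gt0 R) Clt.
have S0 : 0 < sin (k * (2^-1 - eps)) by apply: sin_gt0_pi; apply/andP; split; lra.
(* This quantity is three times the squared cosine minus 2, and the squared cosine exceeds 2/3. *)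
have D0 : 0 < cos (k * (2^-1 - eps)) ^+ 2 - 2 * sin (k * (2^-1 - eps)) ^+ 2.
  rewrite sin2cos2; have := cos_gangle_sqr R; have := cos_gangle_gt0 R.
  by move: Clt C0; move: (cos _) (cos _) => x y; nra.
have ck : 0 < cos k by apply: cos_gt0_pihalf; apply/andP; split; lra.
have sk : 0 < sin k by apply: sin_gt0_pi; apply/andP; split; lra.
have [a [b [p [q []]]]] := gamma_eigen_shape k0 (lt0r_neq0 C0) fE.
move: C0 S0 D0; set C := cos _; set S := sin _; set D := C ^+ 2 - _.
move=> C0 S0 D0 [pE qE bE sumE] fP fleaf fin.
have ba : b = a by apply: (mulIf (lt0r_neq0 D0)).
have a0 : a = 0.
  (* Multiplying Kirchhoff's relation at [v_0] by [cos k] eliminates [p] and [q]; the remaining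
     coefficient of [a] is positive. *)
  have : a * (6 * C * S * cos k + 2 * D * sin k) = 0.
    transitivity (6 * C * S * a * cos k + (p * cos k + q * cos k) * sin k).
      by rewrite pE qE; ring.
    transitivity (cos k * (3 * C * S * (a + b) + (p + q) * sin k)).
      by rewrite ba; ring.
    by rewrite sumE mulr0.
  move=> /eqP; rewrite mulf_eq0 => /orP[/eqP //|/eqP coef].
  suff : 0 < 6 * C * S * cos k + 2 * D * sin k by rewrite coef ltxx.
  by rewrite addr_gt0 ?mulr_gt0.
have pz : p = 0 by apply: (mulIf (lt0r_neq0 ck)); rewrite pE a0 !mul0r.
have qz : q = 0 by apply: (mulIf (lt0r_neq0 ck)); rewrite qE a0 !mul0r.
move=> r; have [e [x [xe ->]]] := pt_surj r.
have bz : b = 0 by rewrite ba.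
case: e xe => /= xe.
- by have [-> _] := fP x xe; rewrite pz mul0r.
- by have [_ ->] := fP x xe; rewrite qz mul0r.
- by have [-> _] := fin x xe; rewrite a0 mul0r.
- by have [_ ->] := fin x xe; rewrite bz mul0r.
- by have [-> _ _ _] := fleaf x xe; rewrite a0 mul0r.
- by have [_ -> _ _] := fleaf x xe; rewrite a0 mul0r.
- by have [_ _ -> _] := fleaf x xe; rewrite bz mul0r.
- by have [_ _ _ ->] := fleaf x xe; rewrite bz mul0r.
Qed.

(** * The explicit eigenfunction and its extrema *)

Definition gamp (R : realType) (e : gedge) : R :=
  match e with
  | e_l | e_r => 0
  | e_u => cos (gangle R) | e_d => - cos (gangle R)
  | e_u1 | e_u2 => 1 | e_d1 | e_d2 => -1
  end.

Definition gflux (R : realType) (e : gedge) : R :=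
  match e with
  | e_u => 2 * sin (gangle R) | e_d => - (2 * sin (gangle R)) | _ => 0
  end.

(** The expansion at the target end, with [gamp] the value there and [gflux] the derivative there
    divided by the frequency. *)
Definition gmode_edge (R : realType) (eps : R) (e : gedge) (x : R) : R :=
  gamp R e * cos (gfreq eps * (glen eps e - x))
  - gflux R e * sin (gfreq eps * (glen eps e - x)).

Definition gmode_vertex (R : realType) (v : gvertex) : R :=
  match v with
  | v_0 | v_l | v_r => 0
  | w_u => cos (gangle R) | w_d => - cos (gangle R)
  | v_u1 | v_u2 => 1 | v_d1 | v_d2 => -1
  end.

Definition gmode (R : realType) (eps : R) (heps : 0 < eps < 2^-1) :
    mg_point (Gamma heps) -> R :=
  mg_glue (gmode_vertex R : vertex (Gamma heps) -> R)
    (gmode_edge eps : edge (Gamma heps) -> R -> R).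

Lemma gmode_pt (R : realType) (eps : R) (heps : 0 < eps < 2^-1)
    (e : edge (Gamma heps)) (x : R) :
  0 <= x <= len e -> gmode (pt e x) = gmode_edge eps e x.
Proof.
apply: mg_glue_pt => {}e.
  have := cos_gangle_sqr R; have := sin_gangle_sqr R => s2 c2.
  (* On [e_u] and [e_d], continuity at [v_0] is the identity [cos^2 = 2 * sin^2] at [gangle R]. *)
  by case: e; rewrite /gmode_edge /= subr0 ?(gfreqE heps); nra.
by case: e; rewrite /gmode_edge /= subrr mulr0 cos0 sin0; lra.
Qed.

Lemma gmode_eigen (R : realType) (eps : R) (heps : 0 < eps < 2^-1) :
  mg_eigenspace (gfreq eps ^+ 2) (@gmode _ _ heps).
Proof.
have dk (e : gedge) (x : R) :
    is_derive x 1 (fun t => gfreq eps * (glen eps e - t)) (- gfreq eps).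
  by apply: trigger_derive; rewrite /GRing.scale/=; ring.
have dcos (e : gedge) (x : R) :
    is_derive x 1 (fun t => cos (gfreq eps * (glen eps e - t)))
      (- sin (gfreq eps * (glen eps e - x)) * - gfreq eps).
  exact: (@is_derive1_comp _ cos (fun t => gfreq eps * (glen eps e - t))).
have dsin (e : gedge) (x : R) :
    is_derive x 1 (fun t => sin (gfreq eps * (glen eps e - t)))
      (cos (gfreq eps * (glen eps e - x)) * - gfreq eps).
  exact: (@is_derive1_comp _ sin (fun t => gfreq eps * (glen eps e - t))).
apply: (@mem_eigenspace _ _ _ _ (gmode_edge eps : edge (Gamma heps) -> R -> R)
  (fun e x => gfreq eps * (gamp R e * sin (gfreq eps * (glen eps e - x))
    + gflux R e * cos (gfreq eps * (glen eps e - x))))).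
- exact: gmode_pt.
- move=> e t; have := dcos e t; have := dsin e t => ? ?.
  by apply: trigger_derive; rewrite /GRing.scale/=; ring.
- move=> e t; have := dcos e t; have := dsin e t => ? ?.
  by apply: trigger_derive; rewrite /gmode_edge /GRing.scale/=; ring.
apply/gkirchhoffP; rewrite /= !subrr !subr0 !mulr0 !cos0 !sin0 !(gfreqE heps).
by repeat split; ring.
Qed.

Lemma eigenspace_gfreq (R : realType) (eps : R) (heps : 0 < eps < 2^-1)
    (f : mg_point (Gamma heps) -> R) : gfreq eps < pi / 2 ->
  mg_eigenspace (gfreq eps ^+ 2) f -> exists a, forall p, f p = a * gmode p.
Proof.
move=> kpi2; have k0 := gfreq_gt0 heps; have p0 := pi_gt0 R.
move=> /(gamma_eigen_shape k0); rewrite (gfreqE heps) => /(_ (lt0r_neq0 (cos_gangle_gt0 R))).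
have ck : 0 < cos (gfreq eps) by apply: cos_gt0_pihalf; apply/andP; split; lra.
have D0 : cos (gangle R) ^+ 2 - 2 * sin (gangle R) ^+ 2 = 0.
  by rewrite cos_gangle_sqr sin_gangle_sqr; lra.
move=> [a [b [p [q []]]]]; rewrite D0 mulr0 => [[pE qE _ sumE] fP fleaf fin].
have pz : p = 0 by apply: (mulIf (lt0r_neq0 ck)); rewrite pE mul0r.
have qz : q = 0 by apply: (mulIf (lt0r_neq0 ck)); rewrite qE mul0r.
(* With [p = q = 0], Kirchhoff's relation reduces to [a + b = 0], the sine and cosine of [gangle R]
   being positive. *)
have ba : b = - a.
  move/eqP: sumE; rewrite pz qz addr0 mul0r addr0 !mulf_eq0 pnatr_eq0/=.
  rewrite (gt_eqF (cos_gangle_gt0 R)) (gt_eqF (sin_gangle_gt0 R))/= addr_eq0 => /eqP ->.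
  by rewrite opprK.
exists a => r; have [e [x [xe ->]]] := pt_surj r.
rewrite gmode_pt// /gmode_edge; case: e xe => /= xe.
- by have [-> _] := fP x xe; rewrite pz; ring.
- by have [_ ->] := fP x xe; rewrite qz; ring.
- by have [-> _] := fin x xe; ring.
- by have [_ ->] := fin x xe; rewrite ba; ring.
- by have [-> _ _ _] := fleaf x xe; ring.
- by have [_ -> _ _] := fleaf x xe; ring.
- by have [_ _ -> _] := fleaf x xe; rewrite ba; ring.
- by have [_ _ _ ->] := fleaf x xe; rewrite ba; ring.
Qed.

(** As [y] stays in [[0, gangle R]], its cosine is at least [cos (gangle R)] and its sine at most
    [sin (gangle R)]. Hence the stem profile lies between [cos^2 - 2 * sin^2 = 0] and
    [cos (gangle R) < 1], and the leaf profile reaches 1 only at [y = 0]. *)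
Lemma gmode_edge_range (R : realType) (eps : R) (heps : 0 < eps < 2^-1) (x : R) :
  0 <= x <= 2^-1 - eps ->
  let y := gfreq eps * (2^-1 - eps - x) in
  [/\ 0 <= cos (gangle R) * cos y - 2 * sin (gangle R) * sin y < 1,
      0 < cos y <= 1 & 1 <= cos y -> x = 2^-1 - eps].
Proof.
move=> /andP[x0 xl] y; have k0 := gfreq_gt0 heps.
have yg : 0 <= y <= gangle R.
  by rewrite -(gfreqE heps) /y; apply/andP; split; nra.
have cy1 := cos_le1 y; have Cy := (gangle_cos_ge yg).1.
have [s0 sS] := andP (gangle_sin_le yg).
have C0 := cos_gangle_gt0 R; have S0 := sin_gangle_gt0 R.
have C2 := cos_gangle_sqr R; have S2 := sin_gangle_sqr R.
split.
- apply/andP; split; nra.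
- by rewrite cy1 (lt_le_trans C0).
move=> c1; have y0 : y = 0.
  have [yge yle] := andP yg.
  apply: cos_inj; rewrite ?in_itv/= ?lexx ?pi_ge0 ?yge ?(le_trans yle)//.
    by case/andP: (gangle_itv R).
  by rewrite cos0; apply/eqP; rewrite eq_le cy1.
move/eqP: y0; rewrite mulf_eq0 (gt_eqF k0)/= => /eqP; lra.
Qed.

Lemma gmode_range (R : realType) (eps : R) (heps : 0 < eps < 2^-1)
    (p : mg_point (Gamma heps)) :
  [/\ -1 <= gmode p <= 1,
      1 <= gmode p -> p = gpt heps v_u1 \/ p = gpt heps v_u2
    & gmode p <= -1 -> p = gpt heps v_d1 \/ p = gpt heps v_d2].
Proof.
have [e [x [xe ->]]] := pt_surj p.
have leafE (d : gedge) : x = glen eps d ->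
    @pt R (Gamma heps) d x = gpt heps (gtgt d).
  by move=> ->; exact: (@pt_len R (Gamma heps)).
rewrite gmode_pt// /gmode_edge; case: e xe => /= xe.
1,2: by rewrite !mul0r subr0 lerN10 ler01 ler10 lerNr oppr0 ler10.
all: have [] := gmode_edge_range heps xe => /andP[i0 i1] /andP[c0 c1] cE.
all: split; first by apply/andP; split; lra.
(* A value 1 or -1 is impossible on the stems [e_u] and [e_d], and on a leaf edge it has the sign of
   that branch. *)
all: move=> b; try (exfalso; lra).
- by left; apply: (leafE e_u1); apply: cE; lra.
- by right; apply: (leafE e_u2); apply: cE; lra.
- by left; apply: (leafE e_d1); apply: cE; lra.
- by right; apply: (leafE e_d2); apply: cE; lra.
Qed.

Lemma gmode_max (R : realType) (eps : R) (heps : 0 < eps < 2^-1) (c : R)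
    (p : mg_point (Gamma heps)) : 0 < c ->
  is_global_max (fun q => c * gmode q) p <->
  p = gpt heps v_u1 \/ p = gpt heps v_u2.
Proof.
move=> c0; split=> [/(_ (gpt heps v_u1))|pE q].
  by rewrite ler_pM2l// => h; have [_ + _] := gmode_range p; exact.
have [/andP[_ q1] _ _] := gmode_range q.
by rewrite ler_pM2l//; case: pE => ->.
Qed.

Lemma gmode_min (R : realType) (eps : R) (heps : 0 < eps < 2^-1) (c : R)
    (p : mg_point (Gamma heps)) : 0 < c ->
  is_global_min (fun q => c * gmode q) p <->
  p = gpt heps v_d1 \/ p = gpt heps v_d2.
Proof.
move=> c0; split=> [/(_ (gpt heps v_d1))|pE q].
  by rewrite ler_pM2l// => h; have [_ _] := gmode_range p; exact.
have [/andP[q1 _] _ _] := gmode_range q.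
by rewrite ler_pM2l//; case: pE => ->.
Qed.

Lemma gmode_P2 (R : realType) (eps : R) (heps : 0 < eps < 2^-1)
    (p : mg_point (Gamma heps)) : P2 heps p -> gmode p = 0.
Proof.
move=> [e eP [x + <-]]; rewrite /= in_itv/= => xe; rewrite gmode_pt//.
by case: eP => ->; rewrite /gmode_edge/= !mul0r subr0.
Qed.

Lemma P2_or_S2 (R : realType) (eps : R) (heps : 0 < eps < 2^-1)
    (p : mg_point (Gamma heps)) : P2 heps p \/ S2 heps p.
Proof.
have [e [x [xe ->]]] := pt_surj p.
have xin : `[0, len e]%classic x by rewrite /= in_itv.
case: e xe xin => xe xin.
- by left; exists e_l; [left|exists x].
- by left; exists e_r; [right|exists x].
- by right; exists e_u; [rewrite /=; tauto|exists x].
- by right; exists e_d; [rewrite /=; tauto|exists x].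
- by right; exists e_u1; [rewrite /=; tauto|exists x].
- by right; exists e_u2; [rewrite /=; tauto|exists x].
- by right; exists e_d1; [rewrite /=; tauto|exists x].
- by right; exists e_d2; [rewrite /=; tauto|exists x].
Qed.

(** * Identification of the second eigenvalue *)

Lemma multiplicity_gfreq (R : realType) (eps : R) (heps : 0 < eps < 2^-1) :
  eps < geps0 R -> multiplicity (Gamma heps) (gfreq eps ^+ 2) 1.
Proof.
move=> e0; apply: (@multiplicity1 _ _ _ (@gmode _ _ heps) (gpt heps v_u1)).
- exact: gmode_eigen.
- exact: oner_neq0.
- by move=> h; apply: eigenspace_gfreq; exact: gfreq_lt_pi2.
Qed.

Lemma is_mu2_gfreq (R : realType) (eps : R) (heps : 0 < eps < 2^-1) :
  eps < geps0 R -> is_mu (Gamma heps) 2 (gfreq eps ^+ 2).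
Proof.
move=> e0; have k0 := gfreq_gt0 heps; have kpi2 := gfreq_lt_pi2 heps e0.
have mu0 : 0 < gfreq eps ^+ 2 by rewrite exprn_gt0.
(* The only eigenvalue below the candidate is 0, which is simple. *)
exists [:: 0]; split=> //=.
- by rewrite andbT ltW.
- move=> x xmu; rewrite (gt_eqF xmu)/= addn0.
  have [x0|x0|->] := ltgtP x 0; last 1 first.
  + by apply: multiplicity_0_connected; [exact: v_0|exact: Gamma_connected].
  + exact: multiplicity_lt0.
  apply: multiplicity0 => f.
  (* For [0 < x < gfreq eps ^+ 2] the frequency is the square root of [x], below both [gfreq eps]
     and [pi / 2]. *)
  have sx0 : 0 < Num.sqrt x by rewrite sqrtr_gt0.
  have sxk : Num.sqrt x < gfreq eps.
    by rewrite -(ltr_pXn2r (isT : (0 < 2)%N)) ?nnegrE ?sqr_sqrtr// ltW.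
  rewrite -[x in mg_eigenspace x](sqr_sqrtr (ltW x0)).
  by apply: eigenspace_below_gfreq; [rewrite sx0|exact: lt_trans kpi2].
exists 1%N; first exact: multiplicity_gfreq.
by rewrite eqxx (lt_eqF mu0).
Qed.

Lemma eigenfunction_gfreq (R : realType) (eps : R) (heps : 0 < eps < 2^-1)
    (f : mg_point (Gamma heps) -> R) :
  eps < geps0 R -> eigenfunction (gfreq eps ^+ 2) f ->
  exists2 a : R, a != 0 & f = (fun p => a * gmode p).
Proof.
move=> e0 [/(eigenspace_gfreq (gfreq_lt_pi2 heps e0))[a fE] [p fp]].
exists a; last exact/funext.
by apply: contra_neq fp => a0; rewrite fE a0 mul0r.
Qed.

Theorem mainTheorem2 (R : realType) :
  (forall (eps : R) (heps : 0 < eps < 2^-1),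
     [/\ is_tree (Gamma heps),
         mg_diam (Gamma heps) = 2%:E,
         (forall p q : mg_point (Gamma heps),
            mg_dist p q = mg_diam (Gamma heps) <->
            (p = gpt heps v_l /\ q = gpt heps v_r) \/
            (p = gpt heps v_r /\ q = gpt heps v_l))
       & (forall P : set (mg_point (Gamma heps)),
            shortest_path (gpt heps v_l) (gpt heps v_r) P <-> P = P2 heps)])
  /\
  (exists2 eps0 : R, 0 < eps0 &
     forall (eps : R) (heps : 0 < eps < 2^-1), eps < eps0 ->
       exists mu2 : R,
         [/\ is_mu (Gamma heps) 2 mu2,
             multiplicity (Gamma heps) mu2 1
           & forall f : mg_point (Gamma heps) -> R, eigenfunction mu2 f ->
               [/\ (forall p, P2 heps p -> f p = 0),
                   (forall p, f p != 0 -> S2 heps p)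
                 & exists2 g : mg_point (Gamma heps) -> R,
                     g = f \/ g = (fun p => - f p) &
                     (forall p, is_global_max g p <->
                        p = gpt heps v_u1 \/ p = gpt heps v_u2) /\
                     (forall p, is_global_min g p <->
                        p = gpt heps v_d1 \/ p = gpt heps v_d2)]])
  /\
  (exists (G : metricGraph R) (mu2 : R) (f : mg_point G -> R),
     [/\ is_tree G, is_mu G 2 mu2, eigenfunction mu2 f
       & forall p, is_global_max f p \/ is_global_min f p ->
           ~ exists q, mg_dist p q = mg_diam G]).
Proof.
split; first by move=> eps heps; split; [exact: Gamma_is_tree
  |exact: mg_diam_Gamma|exact: mg_dist_diam|exact: shortest_path_ends].
split.
  exists (geps0 R) => [|eps heps e0]; first exact: geps0_gt0.
  exists (gfreq eps ^+ 2); split; [exact: is_mu2_gfreq|exact: multiplicity_gfreq|].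
  move=> f /(eigenfunction_gfreq e0)[a a0 ->]; split.
  - by move=> p /gmode_P2 ->; rewrite mulr0.
  - move=> p; have [/gmode_P2 ->|//] := P2_or_S2 p.
    by rewrite mulr0 eqxx.
  (* The sign of the factor [a] decides whether [f] or [- f] has its maximum on the upper branch. *)
  have [an|ap|aE] := ltgtP a 0; last by rewrite aE eqxx in a0.
    exists (fun p => - a * gmode p).
      by right; apply/funext => p; rewrite mulNr.
    by split=> p; [apply: gmode_max|apply: gmode_min]; rewrite oppr_gt0.
  exists (fun p => a * gmode p); first by left.
  by split=> p; [exact: gmode_max|exact: gmode_min].
have e0 := geps0_gt0 R.
have half0 : geps0 R / 2 < geps0 R by lra.
(* Half the threshold is an admissible [eps], since [geps0 R] is less than 1/2; this tree is the
   example for the last claim. *)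
have heps : 0 < geps0 R / 2 < 2^-1.
  have : 0 < gangle R / (pi / 2) by rewrite divr_gt0 ?gangle_gt0// divr_gt0// pi_gt0.
  by move: e0; rewrite /geps0; move: (gangle R / _) => x ? ?; apply/andP; split; lra.
have gE : @gmode _ _ heps = (fun p => 1 * gmode p).
  by apply/funext => p; rewrite mul1r.
exists (Gamma heps), (gfreq (geps0 R / 2) ^+ 2), (@gmode _ _ heps); split.
- exact: Gamma_is_tree.
- exact: is_mu2_gfreq.
- by split; [exact: gmode_eigen|exists (gpt heps v_u1); exact: oner_neq0].
move=> p; rewrite {}gE (gmode_max _ ltr01) (gmode_min _ ltr01) => pE [q].
(* A point realising the diameter is [v_l] or [v_r], while the extrema are the four leaves of
   [S2]. *)
by move=> /mg_dist_diam[] [pE' _]; move: pE; rewrite pE' => -[] [].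
Qed.
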